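(* Let $(M^4,g)$ be an Einstein $4$-manifold with $\mathrm{Ricci}^M = a g$ ($a\in\mathbb{R}$ constant), let $(N^4,h)$ be a Riemannian $4$-manifold, and let $\phi:(M^4,g)\to(N^4,h)$ be a smooth conformal map with $\phi^*h=\lambda^2 g$, where $\lambda:M^4\to\mathbb{R}$ is smooth and $\lambda>0$. Then $\phi$ is biharmonic if and only if $$\Delta\lambda - a\lambda = A\lambda^3$$ for some constant $A$. Furthermore, the constant $A$, the conformal factor $\lambda$ and the scalar curvature $R_h$ of $(N^4,h)$ are governed by the equation $$6A+\frac{2a}{\lambda^2}+R_h=0.$$
   Context: The Laplacian on functions is $\Delta f=\mathrm{div}\,\mathrm{grad} f$ (negative spectrum), taken with respect to $g$. In the last equation $R_h$ is evaluated at $\phi(x)$ and $\lambda$ at $x$, for $x\in M^4$. For a smooth map $\phi:(M,g)\to(N,h)$ between Riemannian manifolds, the tension field is $\tau(\phi)=\mathrm{Tr}_g\nabla d\phi$. The map $\phi$ is biharmonic if it satisfies the Euler–Lagrange equation of the bienergy $\int_M|\tau(\phi)|^2\,dv_g$, namely $$\tau_2(\phi):=-\mathrm{Tr}_g(\nabla^\phi)^2\tau(\phi)-\mathrm{Tr}_g R^N(\tau(\phi),d\phi)d\phi=0,$$ where $\nabla^\phi$ is the pull-back connection on $\phi^{-1}TN$ and $R^N$ is the Riemannian curvature of $N$ with the convention $R(X,Y)Z=\nabla_X\nabla_YZ-\nabla_Y\nabla_XZ-\nabla_{[X,Y]}Z$.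
   Formalization: The manifold M is assumed connected: on a disconnected M (e.g. two unit 4-spheres mapped by homotheties of different ratios) a biharmonic conformal map need not admit a single constant A. *)

(* Defs.v *)
From HB Require Import structures.
From mathcomp Require Import all_boot all_order all_algebra.
From mathcomp Require Import all_classical all_reals all_analysis.
Import Order.TTheory GRing.Theory Num.Theory.
Import numFieldNormedType.Exports.

Set Implicit Arguments.
Unset Strict Implicit.
Unset Printing Implicit Defensive.

Local Open Scope classical_set_scope.
Local Open Scope ring_scope.

Section Smooth.
Variables (R : realType) (n : nat) (V : normedModType R).

(* [Ck k U f]: on the set U, meant to be open, f is of class C^k. *)
Fixpoint Ck (k : nat) (U : set 'rV[R]_n) (f : 'rV[R]_n -> V) : Prop :=
  match k with
  | 0%N => forall x, U x -> {for x, continuous f}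
  | k'.+1 => (forall x, U x -> differentiable f x) /\
             (forall v : 'rV[R]_n, Ck k' U (fun x => 'D_v f x))
  end.

Definition smooth_on (U : set 'rV[R]_n) (f : 'rV[R]_n -> V) : Prop :=
  forall k, Ck k U f.

End Smooth.

(* Index conventions: a metric on a coordinate domain is its Gram matrix
   G x i j = g(d_i, d_j); a vector field, or a vector field along a map, is the
   row of its components. *)
Section Coordinates.
Variables (R : realType) (n : nat).
Implicit Types (G : 'rV[R]_n -> 'M[R]_n) (f : 'rV[R]_n -> R)
  (X : 'rV[R]_n -> 'rV[R]_n) (x : 'rV[R]_n) (i j k l : 'I_n).

Definition partial i f x : R := 'D_(delta_mx 0 i) f x.

(* nabla_(d_i) d_j = sum_k (christoffel G i j k) d_k *)
Definition christoffel G i j k x : R :=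
  2^-1 * \sum_l invmx (G x) k l *
    (partial i (fun y => G y j l) x + partial j (fun y => G y i l) x
     - partial l (fun y => G y i j) x).

(* R(d_i, d_j) d_k = sum_l (riemann G i j k l) d_l, where
   R(X, Y) Z = nabla_X nabla_Y Z - nabla_Y nabla_X Z - nabla_[X, Y] Z *)
Definition riemann G i j k l x : R :=
  partial i (christoffel G j k l) x - partial j (christoffel G i k l) x
  + \sum_s (christoffel G j k s x * christoffel G i s l x
            - christoffel G i k s x * christoffel G j s l x).

(* Ricci(Y, Z) is the trace of X |-> R(X, Y) Z *)
Definition ricci G j k x : R := \sum_i riemann G i j k i x.

Definition scalar_curvature G x : R :=
  \sum_j \sum_k invmx (G x) j k * ricci G j k x.

Definition gradient G f x : 'rV[R]_n :=
  \row_i \sum_j invmx (G x) i j * partial j f x.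

(* div X is the trace of Y |-> nabla_Y X *)
Definition divergence G X x : R :=
  \sum_i (partial i (fun y => X y 0 i) x
          + \sum_j christoffel G i j i x * X x 0 j).

Definition laplacian G f x : R := divergence G (gradient G f) x.

End Coordinates.

Section MapCoordinates.
Variables (R : realType) (m n : nat).
Variables (G : 'rV[R]_m -> 'M[R]_m) (H : 'rV[R]_n -> 'M[R]_n).
Variable F : 'rV[R]_m -> 'rV[R]_n.
Implicit Types (W : 'rV[R]_m -> 'rV[R]_n) (i j : 'I_m) (x : 'rV[R]_m).

(* the field dF(d_i) along F *)
Definition differential_field i x : 'rV[R]_n :=
  \row_b partial i (fun y => F y 0 b) x.

(* nabla^F_(d_i) W, for the pull-back connection on F^-1 TN *)
Definition pullback_nabla i W x : 'rV[R]_n :=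
  \row_b (partial i (fun y => W y 0 b) x
    + \sum_c \sum_e christoffel H c e b (F x)
        * differential_field i x 0 c * W x 0 e).

(* (nabla dF)(d_i, d_j) *)
Definition second_fundamental_form i j x : 'rV[R]_n :=
  pullback_nabla i (differential_field j) x
  - \sum_k christoffel G i j k x *: differential_field k x.

Definition tension x : 'rV[R]_n :=
  \sum_i \sum_j invmx (G x) i j *: second_fundamental_form i j x.

(* ((nabla^F)^2 W)(d_i, d_j)
   = nabla^F_(d_i) nabla^F_(d_j) W - nabla^F_(nabla_(d_i) d_j) W *)
Definition pullback_nabla2 i j W x : 'rV[R]_n :=
  pullback_nabla i (pullback_nabla j W) x
  - \sum_k christoffel G i j k x *: pullback_nabla k W x.

(* R^N(u, v) w at the point y *)
Definition curvature_at (y u v w : 'rV[R]_n) : 'rV[R]_n :=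
  \row_b \sum_c \sum_e \sum_s riemann H c e s b y * u 0 c * v 0 e * w 0 s.

Definition bitension x : 'rV[R]_n :=
  - (\sum_i \sum_j invmx (G x) i j *: pullback_nabla2 i j tension x)
  - \sum_i \sum_j invmx (G x) i j *:
      curvature_at (F x) (tension x) (differential_field i x)
        (differential_field j x).

End MapCoordinates.

(* A chart is a homeomorphism of the open set [dom c] onto an open subset of R^n;
   [param c] is its inverse and is unconstrained off the image of the chart. *)
Record manifold (R : realType) (n : nat) := Manifold {
  space :> topologicalType;
  space_hausdorff : hausdorff_space space;
  space_second_countable : @second_countable space;
  chart_index : Type;
  dom : chart_index -> set space;
  chart : chart_index -> space -> 'rV[R]_n;
  param : chart_index -> 'rV[R]_n -> space;
  dom_open : forall c, open (dom c);
  dom_cover : forall p, exists c, dom c p;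
  codom_open : forall c, open (chart c @` dom c);
  chartK : forall c p, dom c p -> param c (chart c p) = p;
  chart_continuous : forall c p, dom c p -> {for p, continuous (chart c)};
  param_continuous : forall c p, dom c p ->
    {for chart c p, continuous (param c)};
  transition_smooth : forall c d,
    smooth_on (chart c @` (dom c `&` dom d)) (chart d \o param c) }.

Arguments chart_index {R n} m.
Arguments dom {R n m} _ _.
Arguments chart {R n m} _ _.
Arguments param {R n m} _ _.

(* A Riemannian metric as the family of its Gram matrices in the charts.  In
   [metric_transition], 'J f x is the Jacobian acting on row vectors from the
   right ('d f x v = v *m 'J f x), hence the side of the transpose. *)
Record metric (R : realType) (n : nat) (M : manifold R n) := Metric {
  gram :> chart_index M -> 'rV[R]_n -> 'M[R]_n;
  gram_smooth : forall c, smooth_on (chart c @` dom c) (gram c);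
  gram_sym : forall c p, dom c p -> (gram c (chart c p))^T = gram c (chart c p);
  gram_posdef : forall c p, dom c p -> forall v : 'rV[R]_n, v != 0 ->
    0 < (v *m gram c (chart c p) *m v^T) 0 0;
  metric_transition : forall c d p, dom c p -> dom d p ->
    let J := 'J (chart d \o param c) (chart c p) in
    gram c (chart c p) = J *m gram d (chart d p) *m J^T }.

Definition smooth_function (R : realType) (n : nat) (M : manifold R n)
    (f : M -> R) : Prop :=
  forall c : chart_index M, smooth_on (chart c @` dom c) (f \o param c).

Section Maps.
Variables (R : realType) (m n : nat) (M : manifold R m) (N : manifold R n).
Variables (g : metric M) (h : metric N) (phi : M -> N).

Definition local_rep (c : chart_index M) (d : chart_index N) :
  'rV[R]_m -> 'rV[R]_n := chart d \o phi \o param c.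

Definition smooth_map : Prop := continuous phi /\
  forall c d, smooth_on (chart c @` (dom c `&` phi @^-1` dom d))
                        (local_rep c d).

(* phi^* h = lambda^2 g *)
Definition conformal_with_factor (lambda : M -> R) : Prop :=
  forall c d p, dom c p -> dom d (phi p) ->
    let J := 'J (local_rep c d) (chart c p) in
    J *m h d (chart d (phi p)) *m J^T = lambda p ^+ 2 *: g c (chart c p).

(* The bitension field is a section of phi^-1 TN, so that its vanishing does
   not depend on the charts; similarly below for functions and tensors. *)
Definition biharmonic : Prop :=
  forall c d p, dom c p -> dom d (phi p) ->
    bitension (g c) (h d) (local_rep c d) (chart c p) = 0.

End Maps.

Section Geometry.
Variables (R : realType) (n : nat) (M : manifold R n) (g : metric M).

Definition einstein (a : R) : Prop :=
  forall c p, dom c p -> forall j k,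
    ricci (g c) j k (chart c p) = a * g c (chart c p) j k.

End Geometry.

(* Main.v *)
(** Let u = d(log lambda), let W be its g-gradient, and
    S = (Delta lambda)/lambda = div W + |W|^2.
    Along phi the pull-back connection acts on the vectors dphi(V) as
    the Levi-Civita connection of lambda^2 g, which differs from that of g by
    V |-> u(X) V + u(V) X - g(X, V) W.  In dimension 4 this gives
    tau(phi) = - 2 dphi(W), and the Bochner formula together with the conformal
    change of the Ricci tensor gives
      tau_2(phi) = 2 dphi(grad S - 2 (S - a) W)
                 = 2 lambda^2 dphi(grad ((S - a) / lambda^2)),
    so phi is biharmonic iff (S - a) / lambda^2 is locally constant.  Tracing
    the transformed Ricci tensor gives R_h = (4 a - 6 S) / lambda^2; this yields
    the last equation, and also shows that S does not depend on the chart.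

    The smooth functions on a coordinate domain form a commutative ring with
    commuting derivations, and composition with phi is a ring morphism obeying
    the chain rule; the identities above hold over any such data. *)

Require Import Defs.
From HB Require Import structures.
From mathcomp Require Import all_boot all_order all_algebra.
From mathcomp Require Import all_classical all_reals all_analysis.
From mathcomp Require Import ring lra.
Import Order.TTheory GRing.Theory Num.Theory.
Import numFieldNormedType.Exports.
Set Implicit Arguments.
Unset Strict Implicit.
Unset Printing Implicit Defensive.
Local Open Scope classical_set_scope.
Local Open Scope ring_scope.

(** * Commuting derivations *)

(** [bitension] involves fourth derivatives of the map. Over a ring with derivations these are total
    operations, so tensor identities carry no differentiability side conditions and end in [ring];
    smoothness is dealt with when the ring is built and when coordinate expressions are read as
    values of ring elements. The price is that such a ring may have zero divisors: nothing is
    cancelled unless an inverse is supplied by an equation, as in [K *m G = 1%:M], [l' * l = 1] and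
    [half + half = 1]. The Jacobian is inverted in the same way: it is square, so an inverse of the
    pulled-back metric yields one of [J]. Connections are matrices acting on rows from the right,
    which makes [J] a gauge transformation between the conformally changed connection on the source
    and the pull-back connection. It can then be moved to the right end of every expression, and
    what remains is a computation on the source. *)

Lemma eq_of_subr_eq (V : zmodType) (a b x y : V) :
  a = b -> x - y = a - b -> x = y.
Proof. by move=> -> /eqP; rewrite subrr subr_eq0 => /eqP. Qed.

Lemma addmxE (V : nmodType) p q (X Y : 'M[V]_(p, q)) k l :
  (X + Y) k l = X k l + Y k l.
Proof. by rewrite mxE. Qed.

Lemma oppmxE (V : zmodType) p q (X : 'M[V]_(p, q)) k l : (- X) k l = - X k l.
Proof. by rewrite mxE. Qed.

Lemma scalemxE (A : pzRingType) p q a (X : 'M[A]_(p, q)) k l :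
  (a *: X) k l = a * X k l.
Proof. by rewrite mxE. Qed.

(** Products are expanded with [expmxE] and entries then taken with [linmxE], which does not open
    products: the entries of noncommuting matrix products become atoms for [ring]. *)
Definition linmxE := (addmxE, oppmxE, scalemxE).

Definition expmxE := (mulmxDl, mulmxDr, mulNmx, mulmxN, mulmxA).

(** These model the coordinate partial derivatives; as they commute, curvature has no bracket term.
    The ring may be zero, as it is over an empty coordinate domain. *)
Record derivations (A : comPzRingType) (n : nat) := Derivations {
  der :> 'I_n -> {additive A -> A};
  derM : forall i x y, der i (x * y) = der i x * y + x * der i y;
  derC : forall i j x, der i (der j x) = der j (der i x) }.

Section Derivations.
Variables (A : comPzRingType) (n : nat) (d : derivations A n).

Lemma der1 i : d i 1 = 0.
Proof.
have := derM d i 1 1; rewrite !mulr1 mul1r => /eqP.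
by rewrite addrC -subr_eq subrr eq_sym => /eqP.
Qed.

Lemma der_nat i m : d i m%:R = 0.
Proof. by rewrite raddfMn der1 mul0rn. Qed.

Definition dmx i p q (X : 'M[A]_(p, q)) : 'M[A]_(p, q) := map_mx (d i) X.

Lemma dmxE i p q (X : 'M[A]_(p, q)) k l : dmx i X k l = d i (X k l).
Proof. by rewrite mxE. Qed.

Lemma dmxD i p q (X Y : 'M[A]_(p, q)) : dmx i (X + Y) = dmx i X + dmx i Y.
Proof. by apply/matrixP=> k l; rewrite !mxE raddfD. Qed.

Lemma dmxN i p q (X : 'M[A]_(p, q)) : dmx i (- X) = - dmx i X.
Proof. by apply/matrixP=> k l; rewrite !mxE raddfN. Qed.

Lemma dmx_sum i p q I (r : seq I) (P : pred I) (X : I -> 'M[A]_(p, q)) :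
  dmx i (\sum_(s <- r | P s) X s) = \sum_(s <- r | P s) dmx i (X s).
Proof.
apply/matrixP=> k l; rewrite mxE !summxE raddf_sum.
by apply: eq_bigr => s _; rewrite mxE.
Qed.

Lemma dmxM i p q r (X : 'M[A]_(p, q)) (Y : 'M[A]_(q, r)) :
  dmx i (X *m Y) = dmx i X *m Y + X *m dmx i Y.
Proof.
apply/matrixP=> k l; rewrite !mxE raddf_sum -big_split /=.
by apply: eq_bigr => s _; rewrite !mxE derM.
Qed.

Lemma dmxZ i p q (a : A) (X : 'M[A]_(p, q)) :
  dmx i (a *: X) = d i a *: X + a *: dmx i X.
Proof. by apply/matrixP=> k l; rewrite !mxE derM. Qed.

Lemma dmx_tr i p q (X : 'M[A]_(p, q)) : dmx i X^T = (dmx i X)^T.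
Proof. by apply/matrixP=> k l; rewrite !mxE. Qed.

Lemma dmx_trace i p (X : 'M[A]_p) : \tr (dmx i X) = d i (\tr X).
Proof. by rewrite raddf_sum; apply: eq_bigr => s _; rewrite mxE. Qed.

Lemma dmxC i j p q (X : 'M[A]_(p, q)) : dmx i (dmx j X) = dmx j (dmx i X).
Proof. by apply/matrixP=> k l; rewrite !mxE derC. Qed.

(* [Gamma i] acts on rows from the right: D_i V = d_i V + V *m Gamma i *)
Definition curvature_mx p (Gamma : 'I_n -> 'M[A]_p) i j : 'M[A]_p :=
  dmx i (Gamma j) - dmx j (Gamma i)
  + (Gamma j *m Gamma i - Gamma i *m Gamma j).

Lemma curvature_mxE p (Gamma : 'I_n -> 'M[A]_p) i j k l : curvature_mx Gamma i j
  k l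
  = d i (Gamma j k l) - d j (Gamma i k l)
    + \sum_s (Gamma j k s * Gamma i s l - Gamma i k s * Gamma j s l).
Proof. by rewrite /curvature_mx !linmxE !dmxE sumrB !mxE. Qed.

Lemma curvature_mxC p (Gamma : 'I_n -> 'M[A]_p) i j :
  curvature_mx Gamma i j = - curvature_mx Gamma j i.
Proof. by rewrite /curvature_mx opprD !opprB. Qed.

(** Equivalently, [V |-> V *m J] carries covariant derivatives for [Gamma] to covariant derivatives
    for [Theta]. *)
Definition intertwines p (J : 'M[A]_p) (Gamma Theta : 'I_n -> 'M[A]_p) :=
  forall i, dmx i J + J *m Theta i = Gamma i *m J.

(** Replace the derivatives of [J] twice in d_i d_j J = d_j d_i J: the mixed terms Gamma J Theta
    cancel and the two curvatures remain. *)
Lemma curvature_mx_gauge p (J : 'M[A]_p) (Gamma Theta : 'I_n -> 'M[A]_p) i j :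
  intertwines J Gamma Theta ->
  J *m curvature_mx Theta i j = curvature_mx Gamma i j *m J.
Proof.
move=> JG; have dJ s : dmx s J = Gamma s *m J - J *m Theta s.
  by rewrite -JG addrK.
have := dmxC i j J.
rewrite !dJ !(dmxD, dmxN, dmxM) !dJ /curvature_mx !expmxE.
move=> /matrixP E; apply/matrixP=> k l; move: (E k l).
(* The two sides of the goal have the same difference as those of [E], which is an identity left to
   [ring]. *)
by rewrite !linmxE => /esym/eq_of_subr_eq; apply; ring.
Qed.

End Derivations.

(* [G] is the Gram matrix, [K] its inverse, and [Gamma i] has the entries
   Gamma_(i j)^k in row j and column k. *)
Section LeviCivita.
Variables (A : comPzRingType) (n : nat) (d : derivations A n).
Variables (half : A) (half2 : half + half = 1).
Implicit Types (G K : 'M[A]_n) (Gamma : 'I_n -> 'M[A]_n).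

Definition christoffel_mx G K i : 'M[A]_n :=
  \matrix_(j, k) (half * \sum_l K k l *
     (d i (G j l) + d j (G i l) - d l (G i j))).

Definition levi_civita G Gamma :=
  (forall i j k, Gamma i j k = Gamma j i k) /\
  (forall i, dmx d i G = Gamma i *m G + G *m (Gamma i)^T).

Lemma levi_civitaE G Gamma i j k : G^T = G -> levi_civita G Gamma ->
  d i (G j k) = (Gamma i *m G) j k + (Gamma i *m G) k j.
Proof.
move=> Gs [_ Gm]; rewrite -dmxE Gm addmxE.
by rewrite -{2}Gs -trmx_mul [in X in _ + X]mxE.
Qed.

Lemma levi_civita_torsionE G Gamma i j k : levi_civita G Gamma ->
  (Gamma i *m G) j k = (Gamma j *m G) i k.
Proof. by move=> [Gt _]; rewrite !mxE; apply: eq_bigr=> l _; rewrite Gt. Qed.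

(** Metric compatibility, used twice in d_i d_j G = d_j d_i G, leaves only the curvature terms. *)
Lemma curvature_mx_skew G Gamma i j : levi_civita G Gamma ->
  curvature_mx d Gamma i j *m G = - (G *m (curvature_mx d Gamma i j)^T).
Proof.
move=> [_ Gm]; have := dmxC d i j G.
rewrite !Gm !(dmxD, dmxM) !dmx_tr !Gm /curvature_mx !raddfD !raddfN /=
  !trmx_mul.
rewrite !expmxE => /matrixP E; apply/matrixP=> k l; move: (E k l).
by rewrite !linmxE => /eq_of_subr_eq; apply; ring.
Qed.

Section Inverse.
Variables (G K : 'M[A]_n) (Gs : G^T = G) (KG : K *m G = 1%:M).

Lemma trmx_inverse : K^T = K.
Proof.
have GK : G *m K = 1%:M := mulmx1C KG.
have KTG : K^T *m G = 1%:M by rewrite -{1}Gs -trmx_mul GK trmx1.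
by rewrite -[K^T]mulmx1 -GK mulmxA KTG mul1mx.
Qed.

(** Lowering the upper index gives the Christoffel symbols of the first kind, where the inverse
    metric has disappeared. *)
Lemma christoffel_mx_lower i : christoffel_mx G K i *m G =
  \matrix_(j, m) (half * (d i (G j m) + d j (G i m) - d m (G i j))).
Proof.
set L := RHS; suff -> : christoffel_mx G K i = L *m K.
  by rewrite -mulmxA KG mulmx1.
apply/matrixP=> j k; rewrite !mxE mulr_sumr; apply: eq_bigr => l _.
by rewrite mxE -{2}trmx_inverse mxE mulrCA mulrC.
Qed.

Lemma christoffel_mx_levi_civita : levi_civita G (christoffel_mx G K).
Proof.
have Gji i j : G i j = G j i by rewrite -{1}Gs mxE.
split=> [i j k|i].
  rewrite !mxE; congr (_ * _); apply: eq_bigr => l _; rewrite (Gji i j).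
  by rewrite (addrC (d i _)).
have -> : G *m (christoffel_mx G K i)^T = (christoffel_mx G K i *m G)^T by
  rewrite trmx_mul Gs.
apply/matrixP=> j m; rewrite christoffel_mx_lower !mxE (Gji m j) (Gji i m) (Gji
  i j).
by rewrite -[LHS]mul1r -half2; ring.
Qed.

(** Koszul's argument: compatibility expresses the derivatives of [G] through the lowered symbols,
    and their symmetry makes the alternating sum collapse to twice one of them. *)
Lemma levi_civita_unique Gamma i : levi_civita G Gamma -> Gamma i =
  christoffel_mx G K i.
Proof.
move=> lc; suff : Gamma i *m G = christoffel_mx G K i *m G.
  by move=> /(congr1 (mulmx^~ K)); rewrite /= -!mulmxA (mulmx1C KG) !mulmx1.
rewrite christoffel_mx_lower; apply/matrixP=> j m;
  rewrite [RHS]mxE !(levi_civitaE _ _ _ Gs lc).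
rewrite (levi_civita_torsionE j i _ lc) (levi_civita_torsionE m i _ lc).
(* Writing 1 as [half + half] is what lets [ring] divide by two. *)
rewrite (levi_civita_torsionE m j _ lc) -[LHS]mul1r -half2; ring.
Qed.

End Inverse.
End LeviCivita.

Section Delta.
Variables (A : comPzRingType) (n : nat).

Lemma sumr_deltal (F : 'I_n -> A) j : \sum_i (j == i)%:R * F i = F j.
Proof.
rewrite (bigD1 j) //= eqxx mul1r big1 ?addr0 // => i /negPf ji.
by rewrite eq_sym ji mul0r.
Qed.

Lemma sumr_deltar (F : 'I_n -> A) j : \sum_i F i * (j == i)%:R = F j.
Proof. by under eq_bigr do rewrite mulrC; exact: sumr_deltal. Qed.

Lemma trmx11 (M : 'M[A]_1) : M^T = M.
Proof. by apply/matrixP=> i j; rewrite mxE !ord1. Qed.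

Lemma row_mxE p q (X : 'M[A]_(p, q)) i k : row i X 0 k = X i k.
Proof. by rewrite mxE. Qed.

End Delta.

(** * Conformal change of metric *)

(* [u] is the differential of log l, where the new metric is [l ^+ 2 *: G], and
   [W] its gradient; row j of [nabla_mx] is the derivative of [W] along d_j. *)
Section Conformal.
Variables (A : comPzRingType) (n : nat) (d : derivations A n).
Variables (G K : 'M[A]_n) (Gs : G^T = G) (KG : K *m G = 1%:M).
Variables (Gamma : 'I_n -> 'M[A]_n) (lc : levi_civita d G Gamma).
Variables (u : 'rV[A]_n) (u_closed : forall i j, d i (u 0 j) = d j (u 0 i)).
Variables (W : 'rV[A]_n) (raiseG : W *m G = u).

Let Gji i j : G i j = G j i. Proof. by rewrite -{1}Gs mxE. Qed.

Definition ricci_mx (Theta : 'I_n -> 'M[A]_n) : 'M[A]_n :=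
  \matrix_(j, k) \sum_i curvature_mx d Theta i j k i.

Definition nabla_mx : 'M[A]_n :=
  \matrix_(j, k) (d j (W 0 k) + (W *m Gamma j) 0 k).

(** The covariant derivative of [u], hence the Hessian of log l. *)
Definition hess_mx : 'M[A]_n :=
  \matrix_(i, k) (d i (u 0 k) - (Gamma i *m u^T) k 0).

Definition sqnorm : A := (W *m u^T) 0 0.

Local Notation T := nabla_mx.
Local Notation h := hess_mx.
Local Notation f := sqnorm.

Lemma raise_tr : K *m u^T = W^T.
Proof. by rewrite -raiseG trmx_mul Gs mulmxA KG mul1mx. Qed.

Lemma row_nabla_mx j : row j T = dmx d j W + W *m Gamma j.
Proof. by apply/rowP=> k; rewrite !mxE. Qed.

Lemma row_hess_mx j : row j h = dmx d j u - u *m (Gamma j)^T.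
Proof.
have -> : u *m (Gamma j)^T = (Gamma j *m u^T)^T by rewrite trmx_mul trmxK.
by apply/rowP=> k; rewrite !mxE.
Qed.

Lemma nabla_mxG : T *m G = h.
Proof.
apply/row_matrixP=> j; rewrite row_mul row_nabla_mx row_hess_mx -{1}raiseG.
have [_ Gm] := lc.
by rewrite dmxM Gm mulmxDl !mulmxDr !mulmxA addrA raiseG addrK.
Qed.

Lemma hess_mx_sym : h^T = h.
Proof.
apply/matrixP=> j k; rewrite !mxE u_closed; congr (_ - _).
by apply: eq_bigr=> s _; rewrite (lc.1 k j).
Qed.

Lemma nabla_mx_raise : T *m u^T = h *m W^T.
Proof.
by rewrite -raise_tr mulmxA -nabla_mxG -(mulmxA _ G) (mulmx1C KG) mulmx1.
Qed.

(** The product rule for the pairing of [W] with [u]: the connection terms cancel, and the two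
    halves agree because [u] and [W] are dual. *)
Lemma der_sqnorm m : d m f = (h *m W^T) m 0 *+ 2.
Proof.
rewrite /sqnorm -dmxE dmxM addmxE mulr2n dmx_tr.
have hW : row m h *m W^T = row m T *m u^T.
  by rewrite -!row_mul nabla_mx_raise.
have hW' : row m h *m W^T = W *m (row m h)^T.
  by rewrite -[LHS]trmx11 trmx_mul trmxK.
have -> : (h *m W^T) m 0 = (row m h *m W^T) 0 0 by rewrite -row_mul row_mxE.
rewrite {1}hW hW' row_nabla_mx row_hess_mx -!addmxE.
by congr (_ 0 0); rewrite raddfB /= trmx_mul trmxK !expmxE addrACA subrr addr0.
Qed.

Definition nabla_end (Theta : 'I_n -> 'M[A]_n) i (X : 'M[A]_n) : 'M[A]_n :=
  dmx d i X + X *m Theta i - Theta i *m X.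

Lemma trace_nabla_end Theta i X : \tr (nabla_end Theta i X) = d i (\tr X).
Proof. by rewrite !raddfD raddfN /= dmx_trace mxtrace_mulC addrK. Qed.

Lemma nabla_end_lower i :
  nabla_end Gamma i T *m G = dmx d i h - h *m (Gamma i)^T - Gamma i *m h.
Proof.
have [_ Gm] := lc; rewrite -nabla_mxG dmxM Gm !expmxE.
by apply/matrixP=> j k; rewrite !linmxE; ring.
Qed.

Lemma nabla_end_lower_sym i :
  (nabla_end Gamma i T *m G)^T = nabla_end Gamma i T *m G.
Proof.
rewrite nabla_end_lower !raddfB /= !trmx_mul trmxK hess_mx_sym -dmx_tr.
by rewrite hess_mx_sym addrAC.
Qed.

(** The Ricci identity for second covariant derivatives of [W]; vanishing torsion cancels the
    connection terms of the lower slot. *)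
Lemma nabla_end_curv i m k : nabla_end Gamma i T m k
  = nabla_end Gamma m T i k + (W *m curvature_mx d Gamma i m) 0 k.
Proof.
have rowE a b : row b (nabla_end Gamma a T)
    = dmx d a (row b T) + row b T *m Gamma a - row b (Gamma a) *m T.
  rewrite /nabla_end !raddfB !raddfD /= !row_mul; congr (_ + _ - _).
  by apply/rowP=> s; rewrite !mxE.
rewrite -row_mxE -[X in _ = X + _]row_mxE !rowE !row_nabla_mx.
have -> : row m (Gamma i) = row i (Gamma m).
  by apply/rowP=> s; rewrite !mxE lc.1.
rewrite /curvature_mx !dmxD !dmxM (dmxC _ i m) !expmxE !linmxE; ring.
Qed.

(* The rough Laplacian of a gradient: the Hessian is symmetric, so the trace
   can be moved to the slot where commuting derivatives produces Ricci. *)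
Lemma bochner m : \sum_i (K *m nabla_end Gamma i T *m G) i m
  = d m (\tr T) + (W *m (ricci_mx Gamma)^T) 0 m.
Proof.
rewrite -(trace_nabla_end Gamma).
have -> : (W *m (ricci_mx Gamma)^T) 0 m = \sum_i (W *m curvature_mx d Gamma i m)
  0 i.
  rewrite mxE; under [RHS]eq_bigr do rewrite mxE.
  rewrite exchange_big /=; apply: eq_bigr => k _.
  by rewrite !mxE mulr_sumr.
rewrite /mxtrace -big_split /=; apply: eq_bigr => i _; rewrite -nabla_end_curv.
rewrite -mulmxA -nabla_end_lower_sym -(trmx_inverse Gs KG) -trmx_mul mxE.
by rewrite -mulmxA (mulmx1C KG) mulmx1.
Qed.

(* Levi-Civita connection of [l ^+ 2 *: G] minus that of [G] *)
Definition conn_diff i : 'M[A]_n := \matrix_(k, l)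
  (u 0 i * (k == l)%:R + u 0 k * (i == l)%:R - G k i * W 0 l).

Local Notation C := conn_diff.

Lemma conn_diffE i k l :
  C i k l = u 0 i * (k == l)%:R + u 0 k * (i == l)%:R - G k i * W 0 l.
Proof. by rewrite mxE. Qed.

(** A scalar matrix plus two matrices of rank one: products with [C i] reduce to contractions with
    [u], [W] and [G]. *)
Lemma conn_diff_mx i : C i = u 0 i *: 1%:M + u^T *m delta_mx 0 i - col i G *m W.
Proof.
apply/matrixP=> k l; rewrite conn_diffE !linmxE !mxE !big_ord1 !mxE eqxx.
by rewrite (eq_sym l).
Qed.

Lemma mul_conn_diffE p (X : 'M[A]_(p, n)) i k l : (X *m C i) k l =
  u 0 i * X k l + (X *m u^T) k 0 * (i == l)%:R - (X *m G) k i * W 0 l.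
Proof.
rewrite conn_diff_mx mulmxBr mulmxDr -scalemxAr mulmx1 !mulmxA !linmxE.
congr (_ + _ - _); first by rewrite mxE big_ord1 [delta_mx _ _ _ _]mxE eqxx
  eq_sym.
rewrite [LHS]mxE big_ord1; congr (_ * _).
by rewrite !mxE; apply: eq_bigr => s _; rewrite mxE.
Qed.

Lemma conn_diff_u j k : (C j *m u^T) k 0 = u 0 j * u 0 k *+ 2 - G j k * f.
Proof.
have ju : (delta_mx 0 j *m u^T : 'M[A]_1) = (u 0 j)%:M.
  by rewrite -rowE; apply/rowP=> s; rewrite !mxE ord1.
rewrite conn_diff_mx mulmxBl mulmxDl -scalemxAl mul1mx -!mulmxA ju.
rewrite [W *m _]mx11_scalar -/f !mul_mx_scalar !linmxE !mxE (Gji k j).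
by ring.
Qed.

Lemma conn_diff_G j k i :
  (C j *m G) k i = u 0 j * G k i + u 0 k * G j i - G j k * u 0 i.
Proof.
rewrite conn_diff_mx mulmxBl mulmxDl -scalemxAl mul1mx -!mulmxA raiseG !linmxE
  -rowE.
rewrite !mxE !big_ord1 !mxE (Gji k j) //.
Qed.

Lemma conn_diff_mul j i k l : (C j *m C i) k l =
  u 0 i * (C j k l) + (u 0 j * u 0 k *+ 2 - G j k * f) * (i == l)%:R
  - (u 0 j * G k i + u 0 k * G j i - G j k * u 0 i) * W 0 l.
Proof. by rewrite mul_conn_diffE conn_diff_u conn_diff_G. Qed.

(** The symmetric part of [C i *m G] is [u 0 i *: G], which accounts for the derivative of
    [l ^+ 2]. *)
Lemma conformal_levi_civita l : (forall i, d i l = l * u 0 i) ->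
  levi_civita d (l ^+ 2 *: G) (fun i => Gamma i + C i).
Proof.
move=> dl; have [Gt Gm] := lc; split=> [i j k|i].
  by rewrite !addmxE !conn_diffE Gt (Gji j i) (addrC (u 0 i * _)).
rewrite dmxZ derM dl Gm [(Gamma i + C i)^T]raddfD /= mulmxDl mulmxDr -!scalemxAl
  -!scalemxAr.
have GC j k : (G *m (C i)^T) j k = (C i *m G) k j.
  by rewrite -{1}Gs -trmx_mul mxE.
apply/matrixP=> j k; rewrite !linmxE GC !conn_diff_G.
rewrite (Gji k j) (Gji i j) (Gji i k); ring.
Qed.

(** The antisymmetrised covariant derivative of [C] gives the terms in [h] and [T], and the
    commutator of [C] those quadratic in [u]. *)
Lemma curvature_mx_conformal i j k l : curvature_mx d (fun s => Gamma s + C s) i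
  j k l
  = curvature_mx d Gamma i j k l
  + h i k * (j == l)%:R - h j k * (i == l)%:R - G j k * T i l + G i k * T j l
  - u 0 i * u 0 k * (j == l)%:R + u 0 j * u 0 k * (i == l)%:R
  - f * (G j k * (i == l)%:R - G i k * (j == l)%:R)
  + (G j k * u 0 i - G i k * u 0 j) * W 0 l.
Proof.
have dC a b : dmx d a (C b) k l = d a (u 0 b) * (k == l)%:R
   + d a (u 0 k) * (b == l)%:R
   - ((Gamma a *m G) k b + (Gamma a *m G) b k) * W 0 l - G k b * d a (W 0 l).
  rewrite dmxE conn_diffE raddfB raddfD /= !derM (levi_civitaE _ _ _ Gs lc).
  have dn (b' : bool) : d a b'%:R = 0.
    by case: b'; rewrite ?raddf0 // (der1 d).
  by rewrite !dn; ring.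
have CG a b : (C b *m Gamma a) k l = u 0 b * Gamma a k l
   + u 0 k * Gamma a b l - G k b * (W *m Gamma a) 0 l.
  rewrite conn_diff_mx mulmxBl mulmxDl -scalemxAl mul1mx -!mulmxA -rowE !linmxE.
  by rewrite !mxE !big_ord1 !mxE.
rewrite /curvature_mx !dmxD !expmxE !linmxE !dC !CG !conn_diff_mul
  !mul_conn_diffE.
rewrite (levi_civita_torsionE i j k lc) (u_closed i j).
rewrite [h i k]mxE [h j k]mxE [T i l]mxE [T j l]mxE !conn_diffE.
rewrite (lc.1 i j) (Gji k i) (Gji k j) (Gji i j); ring.
Qed.

Let Gammat i := Gamma i + C i.

Lemma raise_sum : \sum_i u 0 i * W 0 i = f.
Proof. by rewrite [f]mxE; apply: eq_bigr => i _; rewrite mxE mulrC. Qed.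

Lemma ricci_conformal j k : ricci_mx Gammat j k
  = ricci_mx Gamma j k - (n%:R - 2) * h j k + (n%:R - 2) * (u 0 j * u 0 k)
    - (\tr T + (n%:R - 2) * f) * G j k.
Proof.
have sh : \sum_i h i k * (j == i)%:R = h j k by rewrite sumr_deltar.
have su : \sum_i u 0 i * u 0 k * (j == i)%:R = u 0 j * u 0 k.
  exact: (sumr_deltar (fun i => u 0 i * u 0 k)).
have sg : \sum_i G i k * (j == i)%:R = G j k by rewrite sumr_deltar.
have sT : \sum_i G i k * T j i = h j k.
  by rewrite -nabla_mxG mxE; apply: eq_bigr=> i _; rewrite mulrC.
have sW : \sum_i G i k * W 0 i = u 0 k.
  by rewrite -raiseG mxE; apply: eq_bigr=> i _; rewrite mulrC.
rewrite [LHS]mxE [ricci_mx _ _ _]mxE.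
(* [c] must be opaque for [big_split] to leave it alone *)
have [c cE] : exists c, c = h j k - u 0 j * u 0 k + f * G j k by eexists.
transitivity (\sum_i (curvature_mx d Gamma i j k i + h i k * (j == i)%:R - c - G
  j k * T i i + G i k * T j i
    - u 0 i * u 0 k * (j == i)%:R + f * (G i k * (j == i)%:R)
    + G j k * (u 0 i * W 0 i) - u 0 j * (G i k * W 0 i))).
  by apply: eq_bigr => i _; rewrite curvature_mx_conformal eqxx cE /=; ring.
rewrite !(big_split, sumrN) /= -!mulr_sumr sh su sg sT sW raise_sum.
rewrite sumr_const card_ord -[_ *+ n]mulr_natl -/(\tr T) cE; ring.
Qed.

(** This trace is the tension of the identity map from [G] to [l ^+ 2 *: G]; in dimension four it is
    -2 W. *)
Lemma trace_conn_diff k : \sum_i (K *m C i) i k = (2 - n%:R) * W 0 k.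
Proof.
transitivity (\sum_i (u 0 i * K i k + (K *m u^T) i 0 * (k == i)%:R - W 0 k)).
  by apply: eq_bigr => i _; rewrite mul_conn_diffE KG [1%:M _ _]mxE eqxx mul1r
    (eq_sym k).
rewrite !(big_split, sumrN) /= sumr_deltar raise_tr sumr_const card_ord.
have -> : \sum_i u 0 i * K i k = W 0 k.
  by rewrite -(mulmx1 W) -(mulmx1C KG) mulmxA raiseG mxE.
by rewrite mxE -mulr_natl; ring.
Qed.

Let P : 'M[A]_n := T + f%:M.

(** In the correction u(X) W + u(W) X - g(X, W) W the outer terms cancel, as [u] is dual to [W];
    only |W|^2 X is left. *)
Lemma nabla_conformal j : dmx d j W + W *m Gammat j = row j P.
Proof.
rewrite mulmxDr addrA -row_nabla_mx [RHS]raddfD /=; congr (_ + _).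
apply/rowP=> k; rewrite mul_conn_diffE raiseG -/f !mxE.
by rewrite addrAC subrr add0r mulr_natr.
Qed.

Lemma mul_conn_diff_G (Y : 'M[A]_n) i k m : (Y *m C i *m G) k m
  = u 0 i * (Y *m G) k m + (Y *m u^T) k 0 * G i m - (Y *m G) k i * u 0 m.
Proof.
rewrite mxE [(Y *m G) k m]mxE.
have -> : u 0 m = \sum_j W 0 j * G j m by rewrite -raiseG mxE.
transitivity (\sum_j (u 0 i * (Y k j * G j m)
    + (Y *m u^T) k 0 * ((i == j)%:R * G j m) - (Y *m G) k i * (W 0 j * G j m))).
  by apply: eq_bigr => j _; rewrite mul_conn_diffE; ring.
by rewrite !(big_split, sumrN) /= -!mulr_sumr sumr_deltal.
Qed.

(** Two connections occur: the vector slot is differentiated along the map, with [Gammat], and the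
    form slot on the source, with [Gamma]. Separating [Gammat] into [Gamma] and [C] leaves the
    Bochner term, the derivative of f Id, and contractions of [P] with [C]. *)
Lemma rough_laplacian m :
  \sum_i (K *m (dmx d i P + P *m Gammat i - Gamma i *m P) *m G) i m
  = d m (\tr T) + (W *m (ricci_mx Gamma)^T) 0 m + d m f *+ 2
    + f * u 0 m *+ 2 - (\tr T + n%:R * f) * u 0 m.
Proof.
have XE i : dmx d i P + P *m Gammat i - Gamma i *m P
  = nabla_end Gamma i T + (d i f)%:M + P *m C i.
  have df : dmx d i f%:M = (d i f)%:M :> 'M[A]_n.
    by apply/matrixP=> k l; rewrite !mxE raddfMn.
  rewrite /nabla_end mulmxDr dmxD df !(mulmxDl T) !(mulmxDr _ T).
  rewrite scalar_mxC.
  by apply/matrixP=> k l; rewrite !linmxE; ring.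
under eq_bigr do rewrite XE mulmxDr mulmxDl mulmxDr mulmxDl 2!addmxE.
rewrite 2!big_split /= bochner -!addrA; congr (_ + (_ + _)).
under eq_bigr do rewrite mul_mx_scalar -scalemxAl KG.
(* One [d m f] is the trace of the derivative of f Id; the other is the sum of the Hessian terms in
   [s1] and [s2], by [der_sqnorm]. *)
transitivity (d m f + (d m f + f * u 0 m *+ 2 - (\tr T + n%:R * f) * u 0 m)).
  congr (_ + _).
    rewrite (bigD1 m) //= !mxE eqxx mulr1 big1 ?addr0 // => i /negPf im.
    by rewrite !mxE im mulr0.
  under eq_bigr do rewrite mulmxA mul_conn_diff_G.
  have PG : P *m G = h + f *: G by rewrite mulmxDl nabla_mxG mul_scalar_mx.
  have Wh : (W *m h) 0 m = (h *m W^T) m 0.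
    by rewrite -{1}hess_mx_sym -{1}[W]trmxK -trmx_mul mxE.
  have s1 : \sum_i u 0 i * (K *m P *m G) i m = (h *m W^T) m 0 + f * u 0 m.
    transitivity ((u *m (K *m P *m G)) 0 m); first by rewrite [RHS]mxE.
    rewrite -raiseG !mulmxA -(mulmxA W) (mulmx1C KG) mulmx1 -mulmxA PG mulmxDr.
    by rewrite -scalemxAr raiseG !linmxE Wh.
  have s2 : \sum_i (K *m P *m u^T) i 0 * G i m = (h *m W^T) m 0 + f * u 0 m.
    transitivity ((G *m (K *m P *m u^T)) m 0).
      by rewrite [RHS]mxE; apply: eq_bigr => i _; rewrite mulrC (Gji i).
    rewrite !mulmxA (mulmx1C KG) mul1mx mulmxDl nabla_mx_raise mul_scalar_mx.
    by rewrite !linmxE [u^T _ _]mxE.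
  have s3 : \sum_i (K *m P *m G) i i = \tr T + n%:R * f.
    rewrite -/(\tr (K *m P *m G)) -mulmxA mxtrace_mulC -mulmxA (mulmx1C KG).
    by rewrite mulmx1 raddfD /= mxtrace_scalar mulr_natl.
  rewrite !(big_split, sumrN) /= -mulr_suml s1 s2 s3 der_sqnorm; ring.
by ring.
Qed.

(** Skewness exchanges the last two slots of the curvature, which turns this metric contraction into
    the trace defining Ricci. *)
Lemma curvature_mx_trace (Theta : 'I_n -> 'M[A]_n) s m :
  (forall i j, curvature_mx d Theta i j *m G = - (G *m (curvature_mx d Theta i
    j)^T)) ->
  \sum_i (K *m curvature_mx d Theta s i *m G) i m = ricci_mx Theta s m.
Proof.
move=> skew; rewrite mxE; apply: eq_bigr => i _.
rewrite -mulmxA skew mulmxN mulmxA KG mul1mx oppmxE mxE.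
by rewrite [in RHS]curvature_mxC oppmxE.
Qed.

(* Minus the bitension of the identity map from [G] to [l ^+ 2 *: G], up to the
   factor 2 - n in the tension [(2 - n) W] and lowered with [G]; row j of [X] is
   the derivative of [W] along d_j for the connection [Theta]. *)
Definition bitension_covector (Theta : 'I_n -> 'M[A]_n) (X : 'M[A]_n) m : A :=
  \sum_i (K *m (dmx d i X + X *m Theta i - Gamma i *m X) *m G) i m
  + \sum_s W 0 s * \sum_i (K *m curvature_mx d Theta s i *m G) i m.

Section UnitFactor.
Variables (l l' : A) (dl : forall i, d i l = l * u 0 i) (ll : l' * l = 1).

Lemma curvature_mx_conformal_skew i j :
  curvature_mx d Gammat i j *m G = - (G *m (curvature_mx d Gammat i j)^T).
Proof.
have := curvature_mx_skew i j (conformal_levi_civita dl).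
rewrite -scalemxAr -scalemxAl -scalerN => /(congr1 ( *:%R (l' ^+ 2))).
by rewrite !scalerA -exprMn ll expr1n !scale1r.
Qed.

Hypothesis n4 : n%:R = 4 :> A.
Variables (a : A) (einstein : ricci_mx Gamma = a *: G).

(** This is where dimension four matters. For general n the coefficients of [d m f] and [f * u 0 m]
    would be (6 - n) / 2 and 2 - n; at n = 4 they are 1 and -2, the same as those of [\tr T], so
    everything groups into [\tr T + f]. *)
Lemma bitension_conformal m : bitension_covector Gammat P m
  = d m (\tr T + f) + 2 * (a - (\tr T + f)) * u 0 m.
Proof.
have Wh : \sum_s W 0 s * h s m = (h *m W^T) m 0.
  rewrite [RHS]mxE; apply: eq_bigr => s _.
  by rewrite mulrC -{1}hess_mx_sym !mxE.
have Wg : \sum_s W 0 s * G s m = u 0 m by rewrite -raiseG mxE.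
have Wu : \sum_s W 0 s * u 0 s = f.
  by rewrite -raise_sum; apply: eq_bigr => s _; rewrite mulrC.
rewrite /bitension_covector rough_laplacian einstein raddfD /= n4.
under eq_bigr do rewrite (curvature_mx_trace _ _ curvature_mx_conformal_skew).
transitivity (d m (\tr T) + a * u 0 m + d m f *+ 2 + f * u 0 m *+ 2 -
  (\tr T + 4 * f) * u 0 m + \sum_s (a * (W 0 s * G s m)
   - 2 * (W 0 s * h s m) + 2 * (W 0 s * u 0 s) * u 0 m
   - (\tr T + 2 * f) * (W 0 s * G s m))).
  congr (_ + _ + _ + _ - _ + _).
    by rewrite linearZ /= -scalemxAr Gs raiseG mxE.
  by apply: eq_bigr => s _; rewrite ricci_conformal einstein n4 mxE; ring.
rewrite !(big_split, sumrN) /= -!mulr_suml -!mulr_sumr Wh Wg Wu der_sqnorm;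
  ring.
Qed.

Lemma scalar_conformal : \sum_j \sum_k K j k * ricci_mx Gammat j k
  = 4 * a - 6 * (\tr T + f).
Proof.
have sumK (X : 'M[A]_n) : \sum_j \sum_k K j k * X j k = \tr (X *m K).
  rewrite mxtrace_mulC -{1}(trmx_inverse Gs KG) exchange_big.
  by apply: eq_bigr => j _; rewrite [RHS]mxE; apply: eq_bigr => k _;
    rewrite mxE.
have -> : ricci_mx Gammat = (a - (\tr T + 2 * f)) *: G - 2 *: h
    + 2 *: (u^T *m u).
  apply/matrixP=> j k; rewrite ricci_conformal einstein n4 !linmxE.
  by rewrite [(u^T *m u) j k]mxE big_ord1 [u^T _ _]mxE; ring.
rewrite sumK !mulmxDl mulNmx -!scalemxAl !linearD !linearN !linearZ /=.
rewrite (mulmx1C KG) -nabla_mxG -!mulmxA (mulmx1C KG) mulmx1 mxtrace1 n4.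
have -> : u *m K = W by rewrite -raiseG -mulmxA (mulmx1C KG) mulmx1.
rewrite mxtrace_mulC [\tr (W *m _)]big_ord1 -/f; ring.
Qed.

End UnitFactor.

End Conformal.

(** * Pull-back of the target metric *)

(* [F] is composition with the map, [J] its Jacobian acting on rows, and [E] the
   inverse of the pulled-back metric. *)
Section Pullback.
Variables (A B : comPzRingType) (n : nat).
Variables (dA : derivations A n) (dB : derivations B n).
Variables (F : {rmorphism B -> A}) (J : 'M[A]_n).
Variables (J_closed : forall i j b, dA i (J j b) = dA j (J i b)).
Variables (chain : forall i b, dA i (F b) = \sum_c J i c * F (dB c b)).
Variables (H : 'M[B]_n) (L : 'M[B]_n) (Hs : H^T = H) (LH : L *m H = 1%:M).
Variables (Om : 'I_n -> 'M[B]_n) (lcH : levi_civita dB H Om).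
Variables (half : A) (half2 : half + half = 1).
Variables (E : 'M[A]_n) (EE : E *m (J *m map_mx F H *m J^T) = 1%:M).

Local Notation "X ^F" := (map_mx F X) (at level 2, format "X ^F").

Lemma dmx_pullback p q i (X : 'M[B]_(p, q)) :
  dmx dA i X^F = \sum_c J i c *: (dmx dB c X)^F.
Proof.
apply/matrixP=> k l; rewrite !mxE chain summxE.
by apply: eq_bigr => c _; rewrite !mxE.
Qed.

Definition pullback_conn i : 'M[A]_n := \sum_c J i c *: (Om c)^F.

Local Notation Theta := pullback_conn.

(** A right inverse of [J], read off from [E]; since [J] is square it is also a left inverse. *)
Let J' := H^F *m J^T *m E.

Lemma mul_jacobian_inv : J *m J' = 1%:M.
Proof. by rewrite /J' !mulmxA (mulmx1C EE). Qed.

Let J'J : J' *m J = 1%:M := mulmx1C mul_jacobian_inv.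

(** The terms containing derivatives of [J] cancel by [J_closed], the symmetry of the second
    derivatives of the map. *)
Lemma curvature_mx_pullback i j : curvature_mx dA Theta i j
  = \sum_c \sum_e (J i c * J j e) *: (curvature_mx dB Om c e)^F.
Proof.
have dT a b : dmx dA a (Theta b) = \sum_e dA a (J b e) *: (Om e)^F
    + \sum_c \sum_e (J a c * J b e) *: (dmx dB c (Om e))^F.
  rewrite dmx_sum exchange_big -big_split; apply: eq_bigr => e _ /=.
  rewrite dmxZ dmx_pullback scaler_sumr; congr (_ + _).
  by apply: eq_bigr => c _; rewrite scalerA mulrC.
have TT a b : Theta a *m Theta b
    = \sum_c \sum_e (J b c * J a e) *: (Om e *m Om c)^F.
  rewrite mulmx_sumr; apply: eq_bigr => c _; rewrite mulmx_suml.
  by apply: eq_bigr => e _; rewrite map_mxM -scalemxAl -scalemxAr scalerA mulrC.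
rewrite /curvature_mx !dT !TT.
rewrite [\sum_c \sum_e (J j c * J i e) *: (dmx _ _ _)^F]exchange_big.
rewrite [\sum_c \sum_e (J j c * J i e) *: (_ *m _)^F]exchange_big /=.
under [\sum_e dA j _ *: _]eq_bigr do rewrite -J_closed.
rewrite opprD (addrACA (\sum_e dA i _ *: _)) subrr add0r -!sumrB -big_split.
apply: eq_bigr => c _ /=.
rewrite -!sumrB -big_split; apply: eq_bigr => e _ /=.
rewrite (mulrC (J j e)) -!scalerBr -scalerDr; congr (_ *: _).
by rewrite [RHS]raddfD !raddfB.
Qed.

Section Gauge.
Variables (Gamma : 'I_n -> 'M[A]_n).
Hypothesis lcG : levi_civita dA (J *m H^F *m J^T) Gamma.

(** Transporting [Theta] back by [J] gives a connection that is torsion-free, by [J_closed] and the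
    symmetry of [Om], and compatible with the pulled-back metric; uniqueness identifies it with
    [Gamma]. *)
Lemma intertwines_pullback : intertwines dA J Gamma Theta.
Proof.
pose G := J *m H^F *m J^T.
have Gs : G^T = G by rewrite /G !trmx_mul trmxK map_trmx Hs mulmxA.
pose Gamma' i := (dmx dA i J + J *m Theta i) *m J'.
have GJ i : Gamma' i *m J = dmx dA i J + J *m Theta i.
  by rewrite -mulmxA J'J mulmx1.
suff lc' : levi_civita dA G Gamma'.
  move=> i; rewrite -GJ; congr (_ *m _).
  by rewrite (levi_civita_unique half2 Gs EE _ lc')
     (levi_civita_unique half2 Gs EE _ lcG).
split=> [i j k|i].
  rewrite !mxE; apply: eq_bigr => b _; congr (_ * _).
  rewrite !mxE J_closed; congr (_ + _).
  under eq_bigr do rewrite summxE mulr_sumr.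
  under [RHS]eq_bigr do rewrite summxE mulr_sumr.
  rewrite exchange_big; apply: eq_bigr => c _; apply: eq_bigr => e _ /=.
  by rewrite !mxE lcH.1; ring.
have dH : dmx dA i H^F = Theta i *m H^F + H^F *m (Theta i)^T.
  rewrite dmx_pullback /Theta raddf_sum mulmx_suml mulmx_sumr -big_split.
  apply: eq_bigr => c _ /=; rewrite lcH.2 linearZ /= -scalemxAl -scalemxAr.
  by rewrite raddfD /= !map_mxM map_trmx scalerDr.
have -> : G *m (Gamma' i)^T = (Gamma' i *m G)^T by rewrite -{1}Gs -trmx_mul.
have -> : Gamma' i *m G = (dmx dA i J + J *m Theta i) *m H^F *m J^T.
  by rewrite !mulmxA GJ.
rewrite !dmxM dH dmx_tr !trmx_mul [(_ + _)^T]raddfD /= trmx_mul trmxK map_trmx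
  Hs !expmxE.
by apply/matrixP=> j k; rewrite !linmxE; ring.
Qed.

Lemma curvature_mx_pullback_gauge i j : \sum_c \sum_e (J i c * J j e) *:
  (J *m (curvature_mx dB Om c e)^F) = curvature_mx dA Gamma i j *m J.
Proof.
rewrite -(curvature_mx_gauge i j intertwines_pullback) curvature_mx_pullback
  mulmx_sumr.
apply: eq_bigr => c _; rewrite mulmx_sumr; apply: eq_bigr => e _.
by rewrite scalemxAr.
Qed.

Lemma ricci_pullback :
  ricci_mx dA Gamma = J *m (ricci_mx dB Om)^F *m J^T.
Proof.
have RE i j : curvature_mx dA Gamma i j = \sum_c \sum_e (J i c * J j e) *:
  (J *m (curvature_mx dB Om c e)^F *m J').
  rewrite -[LHS]mulmx1 -mul_jacobian_inv mulmxA -curvature_mx_pullback_gauge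
    mulmx_suml.
  apply: eq_bigr => c _; rewrite mulmx_suml; apply: eq_bigr => e _.
  by rewrite -scalemxAl.
apply/matrixP=> j k; rewrite [LHS]mxE -mulmxA [RHS]mxE.
transitivity (\sum_e J j e * \sum_c (J *m (curvature_mx dB Om c e)^F) k c).
  under eq_bigr do rewrite RE summxE.
  rewrite exchange_big /=.
  under eq_bigr => c _ do under eq_bigr => i _ do rewrite summxE.
  under eq_bigr do rewrite exchange_big /=.
  rewrite exchange_big /=; apply: eq_bigr => e _.
  rewrite mulr_sumr; apply: eq_bigr => c _.
  (* Inserting [J' *m J] produces the factor [J i c] and the sum over i, so that the trace on the
     target matches the one on the source. *)
  have RJ : J *m (curvature_mx dB Om c e)^F = J *m (curvature_mx dB Om c e)^F *m
    J' *m J.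
    by rewrite -(mulmxA _ J') J'J mulmx1.
  rewrite [in RHS]RJ [X in _ * X]mxE mulr_sumr.
  by apply: eq_bigr => i _; rewrite scalemxE; ring.
apply: eq_bigr => e _; congr (_ * _).
under eq_bigr do rewrite mxE.
rewrite exchange_big mxE; apply: eq_bigr => s _ /=.
rewrite !mxE raddf_sum mulr_suml; apply: eq_bigr => c _.
by rewrite !mxE mulrC.
Qed.

Lemma scalar_pullback :
  \sum_j \sum_k E j k * ricci_mx dA Gamma j k
  = F (\sum_j \sum_k L j k * ricci_mx dB Om j k).
Proof.
have sumK (X Y : 'M[A]_n) : \sum_j \sum_k X j k * Y j k = \tr (X *m Y^T).
  apply: eq_bigr => j _; rewrite [RHS]mxE; apply: eq_bigr => k _.
  by rewrite mxE.
transitivity (\sum_j \sum_k L^F j k * (ricci_mx dB Om)^F j k); last first.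
  rewrite rmorph_sum; apply: eq_bigr => j _; rewrite rmorph_sum.
  by apply: eq_bigr => k _; rewrite rmorphM !mxE.
rewrite !sumK ricci_pullback.
(* The inverse of the pulled-back metric, pushed forward by [J], is the inverse of [H] along the
   map. *)
have LF : J^T *m E *m J = L^F.
  have LHF : L^F *m H^F = 1%:M by rewrite -map_mxM LH map_mx1.
  rewrite -[LHS]mul1mx -LHF -mulmxA !(mulmxA H^F) -/J' J'J mulmx1 //.
have -> : (J *m (ricci_mx dB Om)^F *m J^T)^T
    = J *m ((ricci_mx dB Om)^F^T *m J^T).
  by rewrite !trmx_mul trmxK.
by rewrite mulmxA [LHS]mxtrace_mulC -mulmxA (mulmxA J^T) LF mxtrace_mulC.
Qed.

End Gauge.
End Pullback.

(** * Tension and bitension over a ring with derivations *)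

Section FormalLaplacian.
Variables (A : comPzRingType) (n : nat) (d : derivations A n).
Variables (K : 'M[A]_n) (Gamma : 'I_n -> 'M[A]_n) (x : A).

Definition formal_gradient : 'rV[A]_n := \row_i \sum_j K i j * d j x.

Definition formal_laplacian : A :=
  \sum_i (d i (formal_gradient 0 i) + \sum_j Gamma i j i * formal_gradient 0 j).

End FormalLaplacian.

Section FormalBitension.
Variables (A : comPzRingType) (n : nat) (d : derivations A n).
Variables (K : 'M[A]_n) (Gamma Theta : 'I_n -> 'M[A]_n) (J : 'M[A]_n).
Variables (Rm : 'I_n -> 'I_n -> 'M[A]_n).

Definition formal_nabla i (V : 'rV[A]_n) : 'rV[A]_n := dmx d i V + V *m Theta i.

Definition formal_tension : 'rV[A]_n := \sum_i \sum_j K i j *: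
  (formal_nabla i (row j J) - \sum_k Gamma i j k *: row k J).

(** [Rm] is a parameter because the target curvature has entries in the ring of the target and must
    first be composed with the map. *)
Definition formal_curvature (U V X : 'rV[A]_n) : 'rV[A]_n :=
  \row_b \sum_c \sum_e \sum_s Rm c e s b * U 0 c * V 0 e * X 0 s.

Definition formal_bitension : 'rV[A]_n :=
  - (\sum_i \sum_j K i j *: (formal_nabla i (formal_nabla j formal_tension)
       - \sum_k Gamma i j k *: formal_nabla k formal_tension))
  - \sum_i \sum_j K i j *: formal_curvature formal_tension (row i J) (row j J).

End FormalBitension.

Section ConformalMap.
Variables (A B : comPzRingType) (n : nat).
Variables (dA : derivations A n) (dB : derivations B n).
Variables (F : {rmorphism B -> A}) (J : 'M[A]_n).
Variables (J_closed : forall i j b, dA i (J j b) = dA j (J i b)).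
Variables (chain : forall i b, dA i (F b) = \sum_c J i c * F (dB c b)).
Variables (H : 'M[B]_n) (L : 'M[B]_n) (Hs : H^T = H) (LH : L *m H = 1%:M).
Variables (Om : 'I_n -> 'M[B]_n) (lcH : levi_civita dB H Om).
Variables (half : A) (half2 : half + half = 1).
Variables (G K : 'M[A]_n) (Gs : G^T = G) (KG : K *m G = 1%:M).
Variables (Gamma : 'I_n -> 'M[A]_n) (lcG : levi_civita dA G Gamma).
Variables (l l' : A) (ll : l' * l = 1).
Hypothesis conformal : J *m map_mx F H *m J^T = l ^+ 2 *: G.

Let u : 'rV[A]_n := \row_i (l' * dA i l).
Let W : 'rV[A]_n := u *m K.

Local Notation "X ^F" := (map_mx F X) (at level 2, format "X ^F").

Let dl i : dA i l = l * u 0 i.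
Proof. by rewrite mxE mulrA (mulrC l) ll mul1r. Qed.

Let dl' s : dA s l' = - (l' * u 0 s).
Proof.
have := congr1 (fun x => l' * dA s x) ll; rewrite derM der1 mulr0 => E.
by rewrite -[LHS]mulr1 -ll mxE; apply: (eq_of_subr_eq E); ring.
Qed.

Let u_closed i j : dA i (u 0 j) = dA j (u 0 i).
Proof.
rewrite [u 0 j]mxE [u 0 i]mxE !derM !dl' derC ![u 0 _]mxE; ring.
Qed.

Let WG : W *m G = u. Proof. by rewrite -mulmxA KG mulmx1. Qed.

Let E := l' ^+ 2 *: K.

Let EE : E *m (J *m H^F *m J^T) = 1%:M.
Proof.
by rewrite conformal -scalemxAl -scalemxAr scalerA -exprMn ll expr1n scale1r KG.
Qed.

Let Gammat i := Gamma i + conn_diff G u W i.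

Let lct : levi_civita dA (J *m H^F *m J^T) Gammat.
Proof. by rewrite conformal; exact: conformal_levi_civita. Qed.

Let Theta := pullback_conn F J Om.

(** Two descriptions of the Levi-Civita connection of the pulled-back metric meet here: [Gammat],
    from the conformal change, and [Theta], from the target. *)
Let inter : intertwines dA J Gammat Theta.
Proof. exact: (intertwines_pullback J_closed chain Hs lcH half2 EE lct). Qed.

Let c : A := 2 - n%:R.

Let dc i : dA i c = 0.
Proof. by rewrite raddfB /= !der_nat subrr. Qed.

Lemma formal_nablaJ i (V : 'rV[A]_n) :
  formal_nabla dA Theta i (V *m J) = (dmx dA i V + V *m Gammat i) *m J.
Proof.
by rewrite [RHS]mulmxDl -(mulmxA V) -inter mulmxDr mulmxA addrA -dmxM.
Qed.

Lemma sum_row_mul (X : 'I_n -> 'M[A]_n) :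
  \sum_i \sum_j K i j *: row j (X i) = \sum_i row i K *m X i.
Proof.
apply: eq_bigr => i _; rewrite mulmx_sum_row.
by apply: eq_bigr => j _; rewrite mxE.
Qed.

Lemma row_mul_sum (X Y : 'M[A]_n) j :
  \sum_k X j k *: row k Y = row j (X *m Y).
Proof.
rewrite row_mul mulmx_sum_row.
by apply: eq_bigr => k _; rewrite mxE.
Qed.

(** By [inter] the second fundamental form is the difference [conn_diff] of the two Levi-Civita
    connections, followed by [J]; its trace is [trace_conn_diff]. *)
Lemma formal_tensionE : formal_tension dA K Gamma Theta J = c *: (W *m J).
Proof.
rewrite /formal_tension.
under eq_bigr => i _ do under eq_bigr => j _ do rewrite row_mul_sum.
transitivity (\sum_i \sum_j K i j *: row j (conn_diff G u W i *m J)).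
  apply: eq_bigr => i _; apply: eq_bigr => j _; congr (_ *: _).
  have -> : formal_nabla dA Theta i (row j J)
      = row j (dmx dA i J + J *m Theta i).
    by rewrite raddfD /= row_mul; congr (_ + _); apply/rowP=> k; rewrite !mxE.
  by rewrite inter -raddfB /= mulmxDl addrC addKr.
rewrite sum_row_mul scalemxAl.
under eq_bigr do rewrite mulmxA.
rewrite -mulmx_suml; congr (_ *m _); apply/rowP=> k.
rewrite summxE mxE -(trace_conn_diff Gs KG WG).
by apply: eq_bigr => i _; rewrite -row_mul row_mxE.
Qed.

Let Rm c e := (curvature_mx dB Om c e)^F.

Let T := nabla_mx dA Gamma W.
Let f := sqnorm u W.
Let P : 'M[A]_n := T + f%:M.

Lemma formal_curvatureE i j :
  formal_curvature Rm (c *: (W *m J)) (row i J) (row j J)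
  = c *: (row j (\sum_s W 0 s *: curvature_mx dA Gammat s i) *m J).
Proof.
have gauge := curvature_mx_pullback_gauge J_closed chain Hs lcH half2 EE lct.
rewrite -row_mul mulmx_suml.
apply/rowP=> b; rewrite mxE scalemxE row_mxE summxE.
transitivity (\sum_s \sum_e \sum_e' c * (W 0 s * J s e * J i e'
   * (J *m Rm e e') j b)).
  rewrite [RHS]exchange_big /=; apply: eq_bigr => e _.
  rewrite [RHS]exchange_big /=; apply: eq_bigr => e' _.
  transitivity (c * (W *m J) 0 e * J i e' * (J *m Rm e e') j b).
    rewrite [(J *m _) j b]mxE mulr_sumr; apply: eq_bigr => s _.
    by rewrite scalemxE !row_mxE; ring.
  rewrite [(W *m J) 0 e]mxE mulr_sumr !mulr_suml.
  by apply: eq_bigr => s _; ring.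
rewrite mulr_sumr; apply: eq_bigr => s _.
rewrite -scalemxAl -gauge scalemxE summxE !mulr_sumr; apply: eq_bigr => e _.
rewrite summxE !mulr_sumr; apply: eq_bigr => e' _.
by rewrite scalemxE; ring.
Qed.

(** Each derivative passes through [J] by [formal_nablaJ], and [c] is constant. Lowered with [G],
    the vector in front of [J] becomes [bitension_covector]. *)
Lemma formal_bitensionE :
  formal_bitension dA K Gamma Theta J Rm = - (c *: ((
    \sum_i row i K *m (dmx dA i P + P *m Gammat i - Gamma i *m P)
    + \sum_s W 0 s *: \sum_i row i K *m curvature_mx dA Gammat s i) *m J)).
Proof.
have nabla_tension j : formal_nabla dA Theta j (c *: (W *m J))
  = c *: row j (P *m J).
  rewrite scalemxAl formal_nablaJ dmxZ dc scale0r add0r -scalemxAl -scalerDr.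
  by rewrite -scalemxAl (nabla_conformal _ _ WG) row_mul.
rewrite /formal_bitension formal_tensionE mulmxDl scalerDr opprD.
congr (- _ - _).
  rewrite -sum_row_mul mulmx_suml scaler_sumr; apply: eq_bigr => i _.
  rewrite mulmx_suml scaler_sumr; apply: eq_bigr => j _.
  rewrite -scalemxAl scalerA mulrC -scalerA; congr (K i j *: _).
  under eq_bigr do rewrite nabla_tension scalerA mulrC -scalerA.
  rewrite -scaler_sumr row_mul_sum nabla_tension.
  rewrite row_mul scalemxAl formal_nablaJ dmxZ dc scale0r add0r -scalemxAl
    -scalerDr.
  rewrite -scalemxAl -scalerBr mulmxA row_mul -mulmxBl; congr (_ *: (_ *m J)).
  have rowDB (X Y Z : 'M[A]_n) :
      row j (X + Y - Z) = row j X + row j Y - row j Z.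
    by rewrite raddfB raddfD.
  rewrite rowDB !row_mul; congr (_ + _ - _).
  by apply/rowP=> k; rewrite !mxE.
under eq_bigr => i _ do under eq_bigr => j _ do
  rewrite formal_curvatureE scalerA mulrC -scalerA.
under eq_bigr do rewrite -scaler_sumr.
rewrite -scaler_sumr; congr (_ *: _).
transitivity (\sum_i row i K *m
  ((\sum_s W 0 s *: curvature_mx dA Gammat s i) *m J)).
  rewrite -sum_row_mul; apply: eq_bigr => i _; apply: eq_bigr => j _.
  by rewrite row_mul.
under eq_bigr do rewrite mulmxA.
rewrite -mulmx_suml; congr (_ *m J).
under eq_bigr do rewrite mulmx_sumr.
rewrite exchange_big; apply: eq_bigr => s _ /=; rewrite scaler_sumr.
by apply: eq_bigr => i _; rewrite scalemxAr.
Qed.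

Let S := \tr T + f.

Lemma formal_laplacianE : formal_laplacian dA K Gamma l = l * S.
Proof.
have gE i : formal_gradient dA K l 0 i = l * W 0 i.
  rewrite [LHS]mxE [W 0 i]mxE mulr_sumr; apply: eq_bigr => j _.
  by rewrite dl -{1}(trmx_inverse Gs KG) mxE; ring.
rewrite /S /f -raise_sum /mxtrace -big_split mulr_sumr;
  apply: eq_bigr => i _ /=.
rewrite gE derM dl [T i i]mxE [(W *m _) 0 i]mxE.
under eq_bigr => j _ do rewrite gE mulrCA (mulrC (Gamma i j i)).
by rewrite -mulr_sumr; ring.
Qed.

Hypothesis n4 : n%:R = 4 :> A.
Variables (a : A) (da : forall i, dA i a = 0).
Hypothesis einstein : ricci_mx dA Gamma = a *: G.

Lemma formal_biharmonicP : formal_bitension dA K Gamma Theta J Rm = 0 <->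
  forall m, dA m (l' ^+ 2 * (l' * formal_laplacian dA K Gamma l - a)) = 0.
Proof.
rewrite formal_laplacianE mulrA ll mul1r formal_bitensionE.
set b := _ + _.
have bE m : (b *m G) 0 m = dA m S + 2 * (a - S) * u 0 m.
  rewrite -(bitension_conformal Gs KG lcG u_closed WG dl ll n4 einstein).
  rewrite /bitension_covector mulmxDl addmxE mulmx_suml summxE; congr (_ + _).
    by apply: eq_bigr => i _; rewrite -2!row_mul row_mxE.
  rewrite mulmx_suml summxE; apply: eq_bigr => s _.
  rewrite -scalemxAl scalemxE mulmx_suml summxE; congr (_ * _).
  by apply: eq_bigr => i _; rewrite -2!row_mul row_mxE.
(* [l' ^+ 2] is an integrating factor, its derivative being -2 u times itself. *)
have dq m : dA m (l' ^+ 2 * (S - a)) = l' ^+ 2 * (b *m G) 0 m.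
  by rewrite bE expr2 !derM raddfB /= da dl'; ring.
have E0 (V : 'rV[A]_n) (X Y : 'M[A]_n) : X *m Y = 1%:M -> V *m X = 0 -> V = 0.
  by move=> XY V0; rewrite -[V]mulmx1 -XY mulmxA V0 mul0mx.
split=> [/eqP|dq0].
  rewrite oppr_eq0 => /eqP/(congr1 ( *:%R half)); rewrite scaler0 scalerA.
  (* In dimension four [c] is -2, so multiplying by [half] removes it up to sign. *)
  have -> : half * c = - (half + half) by rewrite /c n4; ring.
  rewrite half2 scaleN1r => /eqP; rewrite oppr_eq0 => /eqP bJ m.
  by rewrite dq (E0 _ _ _ (mul_jacobian_inv EE) bJ) mul0mx mxE mulr0.
suff -> : b = 0 by rewrite mul0mx scaler0 oppr0.
apply: (E0 _ _ _ (mulmx1C KG)); apply/rowP=> m; rewrite [RHS]mxE.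
have ll2 : l ^+ 2 * l' ^+ 2 = 1 by rewrite -exprMn mulrC ll expr1n.
by rewrite -[LHS]mul1r -ll2 -mulrA -dq dq0 mulr0.
Qed.

(** The scalar curvature of the pulled-back metric is computed twice: by naturality from the target,
    and by conformal change from the source. *)
Lemma formal_scalar_curvature :
  F (\sum_j \sum_k L j k * ricci_mx dB Om j k)
  = l' ^+ 2 * (4 * a - 6 * (l' * formal_laplacian dA K Gamma l)).
Proof.
rewrite formal_laplacianE (mulrA l' l) ll mul1r.
rewrite -(scalar_conformal Gs KG lcG u_closed WG n4 einstein).
rewrite -(scalar_pullback J_closed chain Hs LH lcH half2 EE lct) mulr_sumr.
apply: eq_bigr => j _; rewrite mulr_sumr; apply: eq_bigr => k _.
by rewrite scalemxE mulrA.
Qed.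

End ConformalMap.

(** * Functions of class C^k *)

Lemma near_eq_differentiable (R : realFieldType) (V W : normedModType R)
    (f g : V -> W) (x : V) :
  (\forall y \near x, f y = g y) -> differentiable f x -> differentiable g x.
Proof.
move=> fg df; apply/diffP => /=.
(* The differential of [g] is defined by choice, so any continuous linear map with the right
   expansion will do; ['d f x] is one. *)
apply: (@getPex _ (fun (dg : {linear V -> W}) => continuous dg /\
  forall y, g y = g (lim (nbhs x)) + dg (y - lim (nbhs x))
                  +o_(y \near x) (y - lim (nbhs x)))).
case: df => -[dc fE]; exists ('d f x); split => //.
suff gE : g = cst (g (lim (nbhs x))) + 'd f x \o center (lim (nbhs x))
   +o_ (nbhs x) (center (lim (nbhs x))).
  by apply: eqaddoEx => y; rewrite [in LHS]gE.
apply/eqaddoP => e e0; move/eqaddoP: fE => /(_ e e0); apply: filter_app.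
have fgx : f (lim (nbhs x)) = g (lim (nbhs x)).
  by rewrite lim_id //; exact: nbhs_singleton fg.
apply: filterS fg => y fgy.
rewrite -[(f - _) y]/(f y - _) -[(g - _) y]/(g y - _) fgy.
by rewrite -fgx.
Qed.

Section CkTheory.
Variables (R : realType) (n : nat) (U : set 'rV[R]_n) (oU : open U).

Let nearU x : U x -> \forall y \near x, U y.
Proof. by move=> Ux; exact: open_nbhs_nbhs. Qed.

Lemma Ck_eq (V : normedModType R) k (f g : 'rV[R]_n -> V) :
  (forall x, U x -> f x = g x) -> Ck k U f -> Ck k U g.
Proof.
elim: k f g => [|k IH] f g fg /=.
  move=> fc x Ux; have fgx : f @ x --> g x by rewrite -fg //; exact: fc.
  have gf : {near nbhs x, f =1 g}.
    by apply: filterS (nearU Ux) => y; exact: fg.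
  exact: cvg_trans (near_eq_cvg gf) fgx.
have near_fg x : U x -> \forall y \near x, f y = g y.
  by move=> Ux; apply: filterS (nearU Ux) => y; exact: fg.
move=> [df Df]; split=> [x Ux|v].
  exact: near_eq_differentiable (near_fg x Ux) (df x Ux).
by apply: IH (Df v) => x Ux; apply: near_eq_derive; exact: near_fg.
Qed.

Lemma Ck_S (V : normedModType R) k (f : 'rV[R]_n -> V) :
  Ck k.+1 U f -> Ck k U f.
Proof.
elim: k f => [|k IH] f /= [df Df].
  by move=> x Ux; apply: differentiable_continuous; exact: df.
by split=> // v; apply: IH; exact: Df.
Qed.

Lemma Ck_cst (V : normedModType R) k (a : V) : Ck k U (fun=> a).
Proof.
elim: k a => [|k IH] a /=; first by move=> x _; exact: cst_continuous.
split=> [x _|v]; first exact: differentiable_cst.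
apply: Ck_eq (IH 0) => x _; by rewrite derive_cst.
Qed.

Lemma CkD (V : normedModType R) k (f g : 'rV[R]_n -> V) :
  Ck k U f -> Ck k U g -> Ck k U (fun x => f x + g x).
Proof.
elim: k f g => [|k IH] f g /=.
  by move=> fc gc x Ux; exact: (@continuousD _ _ _ f g x (fc x Ux) (gc x Ux)).
move=> [df Df] [dg Dg]; split=> [x Ux|v].
  by apply: differentiableD; [exact: df|exact: dg].
apply: Ck_eq (IH _ _ (Df v) (Dg v)) => x Ux.
by rewrite (@deriveD _ _ _ f g) //; apply: diff_derivable;
  [exact: df|exact: dg].
Qed.

Lemma CkM k (f g : 'rV[R]_n -> R) :
  Ck k U f -> Ck k U g -> Ck k U (fun x => f x * g x).
Proof.
elim: k f g => [|k IH] f g.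
  by move=> fc gc x Ux; exact: (@continuousM _ _ f g x (fc x Ux) (gc x Ux)).
move=> sf sg; move: (sf) (sg) => /= [df Df] [dg Dg]; split=> [x Ux|v].
  by apply: differentiableM; [exact: df|exact: dg].
apply: Ck_eq (CkD (IH _ _ (Ck_S sf) (Dg v)) (IH _ _ (Ck_S sg) (Df v))) => x Ux.
by rewrite (@deriveM _ _ f g) //; apply: diff_derivable; [exact: df|exact: dg].
Qed.

Lemma CkN k (f : 'rV[R]_n -> R) : Ck k U f -> Ck k U (fun x => - f x).
Proof.
move=> sf; apply: Ck_eq (CkM (Ck_cst k (-1 : R)) sf) => x _.
by rewrite mulN1r.
Qed.

(** The derivative of 1/f is -(1/f)^2 times that of f, so each class obtained for 1/f yields the
    next one. *)
Lemma CkV k (f : 'rV[R]_n -> R) : (forall x, U x -> f x != 0) ->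
  Ck k U f -> Ck k U (fun x => (f x)^-1).
Proof.
move=> f0; elim: k => [|k IH].
  by move=> /= fc x Ux; apply: continuousV; [exact: f0|exact: fc].
move=> sf; have sV := IH (Ck_S sf); move: (sf) => /= [df Df]; split=> [x Ux|v].
  by apply: differentiableV; [exact: df|exact: f0].
apply: Ck_eq (CkN (CkM (CkM sV sV) (Df v))) => x Ux.
rewrite (@deriveV _ _ f) ?f0 //; last by apply: diff_derivable; exact: df.
by rewrite scaleNr expr2 invfM.
Qed.

Lemma Ck_coord p q k (f : 'rV[R]_n -> 'M[R]_(p, q)) i j :
  Ck k U f -> Ck k U (fun x => f x i j).
Proof.
elim: k f => [|k IH] f /=.
  move=> fc x Ux.
  apply: (@continuous_comp _ _ _ f (fun M : 'M[R]_(p, q) => M i j)).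
    exact: fc.
  exact: coord_continuous.
move=> [df Df]; split=> [x Ux|v].
  apply: (@differentiable_comp _ _ _ _ f (fun M : 'M[R]_(p, q) => M i j)).
    exact: df.
  exact: differentiable_coord.
apply: Ck_eq (IH _ (Df v)) => x Ux.
by rewrite derive_mx ?mxE //; apply: diff_derivable; exact: df.
Qed.

Lemma derive_sum_partial (f : 'rV[R]_n -> R) x v : differentiable f x ->
  'D_v f x = \sum_b v 0 b * partial b f x.
Proof.
move=> df; rewrite {1}(row_sum_delta v) deriveE // linear_sum.
by apply: eq_bigr => b _; rewrite linearZ /= /partial deriveE.
Qed.

Lemma Ck_sum (I : Type) (r : seq I) k (f : I -> 'rV[R]_n -> R) :
  (forall i, Ck k U (f i)) -> Ck k U (fun x => \sum_(i <- r) f i x).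
Proof.
move=> sf; elim: r => [|i r IH].
  by apply: Ck_eq (Ck_cst k 0) => x _; rewrite big_nil.
by apply: Ck_eq (CkD (sf i) IH) => x _; rewrite big_cons.
Qed.

End CkTheory.

Lemma Ck_sub (R : realType) n (V : normedModType R) k (U U' : set 'rV[R]_n)
    (f : 'rV[R]_n -> V) : U' `<=` U -> Ck k U f -> Ck k U' f.
Proof.
move=> UU; elim: k f => [|k IH] f /=; first by move=> fc x /UU; exact: fc.
by move=> [df Df]; split=> [x /UU|v]; [exact: df|exact: IH].
Qed.

Lemma derive_comp_partial (R : realType) m n (F : 'rV[R]_m -> 'rV[R]_n)
    (f : 'rV[R]_n -> R) x v : differentiable F x -> differentiable f (F x) ->
  'D_v (f \o F) x = \sum_b ('D_v F x) 0 b * partial b f (F x).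
Proof.
move=> dF df; rewrite -derive_sum_partial // !deriveE //; last first.
  exact: differentiable_comp.
by rewrite diff_comp.
Qed.

Lemma Ck_comp (R : realType) m n k (U : set 'rV[R]_m) (U' : set 'rV[R]_n)
    (F : 'rV[R]_m -> 'rV[R]_n) (f : 'rV[R]_n -> R) :
  open U -> (forall x, U x -> U' (F x)) ->
  Ck k U F -> Ck k U' f -> Ck k U (f \o F).
Proof.
move=> oU UU; elim: k f => [|k IH] f.
  by move=> /= Fc fc x Ux; apply: continuous_comp; [exact: Fc|exact/fc/UU].
move=> sF sf; move: (sF) (sf) => /= [dF DF] [df Df].
split=> [x Ux|v]; first by apply: differentiable_comp; [exact: dF|exact/df/UU].
have sb b : Ck k U (fun x => ('D_v F x) 0 b * partial b f (F x)).
  apply: CkM => //; first exact: Ck_coord.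
  by apply: IH; [exact: Ck_S|exact: Df].
apply: Ck_eq (Ck_sum oU (index_enum _) sb) => // x Ux.
by rewrite derive_comp_partial //; [exact: dF|exact/df/UU].
Qed.

(** * Mean value theorem: symmetry of second derivatives, and functions with zero derivative *)

Section MeanValue.
Variables (R : realType) (n : nat).
Implicit Types (x v w : 'rV[R]_n) (f g : 'rV[R]_n -> R).

Lemma is_derive_line g x v (t : R) : differentiable g (x + t *: v) ->
  is_derive t 1 (fun s : R => g (x + s *: v)) ('D_v g (x + t *: v)).
Proof.
move=> dg.
have dl : is_diff t (fun s : R => x + s *: v) (fun s : R => s *: v).
  have := is_diffD (is_diff_cst x t) (is_diff_scalel t v).
  by rewrite add0r.
have dgl : differentiable (g \o (fun s : R => x + s *: v)) t.
  by apply: differentiable_comp.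
apply: DeriveDef; first exact: diff_derivable.
rewrite deriveE // deriveE // diff_comp // (@diff_val _ _ _ _ _ _ _ dl) /=.
by rewrite scale1r.
Qed.

Lemma mean_value_line g x v (h : R) : 0 <= h ->
  (forall t, 0 <= t <= h -> differentiable g (x + t *: v)) ->
  exists2 t, 0 <= t <= h & g (x + h *: v) - g x = h * 'D_v g (x + t *: v).
Proof.
move=> h0 dg.
have dline t : t \in `]0, h[ -> is_derive t 1 (fun s : R => g (x + s *: v))
    ('D_v g (x + t *: v)).
  move=> /itvP th; apply: is_derive_line; apply: dg.
  by rewrite !ltW ?th.
have cline : {within `[0, h], continuous (fun s : R => g (x + s *: v))}.
  apply: derivable_within_continuous => t /itvP th.
  by apply: ex_derive; apply: is_derive_line; apply: dg; rewrite !th.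
have [t /itvP th] := MVT_segment h0 dline cline.
by rewrite scale0r addr0 subr0 mulrC => E; exists t => //; rewrite !th.
Qed.

Lemma near_parallelogram (P : 'rV[R]_n -> Prop) x v w :
  (\forall y \near x, P y) -> exists2 h : R, 0 < h &
  forall s t, 0 <= s <= h -> 0 <= t <= h -> P (x + s *: v + t *: w).
Proof.
move=> /nbhs_normP[/= r r0 rP].
have vw0 : 0 < `|v| + `|w| + 1 by rewrite ltr_wpDl // addr_ge0.
(* The added 1 avoids a zero denominator and makes the final bound strict. *)
exists (r / (`|v| + `|w| + 1)); first exact: divr_gt0.
move=> s t /andP[s0 sh] /andP[t0 th]; apply: rP => /=.
rewrite -addrA opprD addNKr normrN (le_lt_trans (ler_normD _ _)) //.
rewrite !normrZ !ger0_norm //.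
have -> : r = r / (`|v| + `|w| + 1) * (`|v| + `|w| + 1).
  by rewrite divfK ?gt_eqF.
move: (r / _) sh th (divr_gt0 r0 vw0) => h sh th h0.
have := ler_wpM2r (normr_ge0 v) sh; have := ler_wpM2r (normr_ge0 w) th.
by move=> h1 h2; rewrite !mulrDr mulr1; lra.
Qed.

(** The mean value theorem is applied along v to y |-> f (y + h w) - f y, then along w to the
    derivative of f along v. *)
Lemma mean_value_parallelogram (U : set 'rV[R]_n) f x v w (h : R) :
  0 <= h -> Ck 2 U f ->
  (forall s t, 0 <= s <= h -> 0 <= t <= h -> U (x + s *: v + t *: w)) ->
  exists s t, [/\ 0 <= s <= h, 0 <= t <= h &
    f (x + h *: v + h *: w) - f (x + h *: v) - (f (x + h *: w) - f x)
    = h ^+ 2 * 'D_w ('D_v f) (x + s *: v + t *: w)].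
Proof.
move=> h0 [df Df] xU; have hh : 0 <= h <= h by rewrite h0 lexx.
have h00 : 0 <= (0 : R) <= h by rewrite h0 lexx.
pose g y := f (y + h *: w) - f y.
have U0 s : 0 <= s <= h -> U (x + s *: v).
  by move=> sh; have := xU s 0 sh h00; rewrite scale0r addr0.
have dsh y : differentiable f (y + h *: w) ->
    is_diff y (fun y => f (y + h *: w)) ('d f (y + h *: w)).
  move=> dfy; have dl : is_diff y (fun y => y + h *: w) id.
    have := is_diffD (is_diff_id y) (is_diff_cst (h *: w) y).
    by rewrite addr0.
  have := @is_diff_comp _ _ _ _ (fun y => y + h *: w) id f _ y dl
    (differentiableP dfy).
  by [].
have dg s : 0 <= s <= h -> is_diff (x + s *: v) g
   (('d f (x + s *: v + h *: w) : 'rV[R]_n -> R)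
    - ('d f (x + s *: v) : 'rV[R]_n -> R)).
  move=> sh; apply: is_diffB; first by apply: dsh; apply: df; exact: xU.
  by apply: differentiableP; apply: df; exact: U0.
have [s sh gs] := mean_value_line h0
  (fun s sh => @ex_diff _ _ _ _ _ _ _ (dg s sh)).
have [Dfd _] := Df v.
have [t th ft] := @mean_value_line ('D_v f) (x + s *: v) w h h0
  (fun t th => Dfd _ (xU s t sh th)).
exists s, t; split=> //.
have -> : f (x + h *: v + h *: w) - f (x + h *: v) - (f (x + h *: w) - f x)
  = g (x + h *: v) - g x by [].
rewrite gs expr2 -mulrA -ft; congr (_ * _).
rewrite deriveE; last exact: @ex_diff _ _ _ _ _ _ _ (dg s sh).
have U1 := xU s h sh hh.
rewrite (deriveE v (df _ U1)) (deriveE v (df _ (U0 s sh))).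
by have /(congr1 (@^~ v)) := @diff_val _ _ _ _ _ _ _ (dg s sh).
Qed.

(** The second difference over a parallelogram is symmetric in v and w, so the two mixed derivatives
    agree at a pair of points arbitrarily close to x; continuity concludes. *)
Lemma derive_schwarz (U : set 'rV[R]_n) f x v w : open U -> U x -> Ck 2 U f ->
  'D_w ('D_v f) x = 'D_v ('D_w f) x.
Proof.
move=> oU Ux sf; have [_ Df] := sf.
have cont v' w' : {for x, continuous ('D_w' ('D_v' f))}.
  exact: (Df v').2.
apply/eqP; rewrite -subr_eq0 -normr_le0; apply/ler_addgt0Pl => e e0.
rewrite addr0.
have e2 : 0 < e / 2 by rewrite divr_gt0.
have near1 v' w' : \forall y \near x,
   `|'D_w' ('D_v' f) x - 'D_w' ('D_v' f) y| < e / 2.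
  by have /cvgrPdist_lt := cont v' w'; apply.
have /(near_parallelogram v w)[h h0 hP] : \forall y \near x, [/\ U y,
    `|'D_w ('D_v f) x - 'D_w ('D_v f) y| < e / 2 &
    `|'D_v ('D_w f) x - 'D_v ('D_w f) y| < e / 2].
  have nU : \forall y \near x, U y by exact: open_nbhs_nbhs.
  by apply: filterS3 nU (near1 v w) (near1 w v) => y.
have [s [t [sh th E1]]] := mean_value_parallelogram (ltW h0) sf
  (fun s t sh th => let: And3 H _ _ := hP s t sh th in H).
have [t' [s' [th' sh' E2]]] := @mean_value_parallelogram U f x w v h (ltW h0) sf
  (fun t s th sh => let: And3 H _ _ := hP s t sh th in
   eq_ind _ U H _ (addrAC _ _ _)).
have E : 'D_w ('D_v f) (x + s *: v + t *: w)
  = 'D_v ('D_w f) (x + s' *: v + t' *: w).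
  apply: (@mulfI _ (h ^+ 2)); first by rewrite expf_neq0 // gt_eqF.
  apply: etrans (esym E1) _; rewrite (addrAC x (s' *: v)); apply: etrans _ E2.
  by rewrite (addrAC x (h *: w)); ring.
have [_ H1 _] := hP s t sh th; have [_ _ H2] := hP s' t' sh' th'.
rewrite -(subrKA ('D_w ('D_v f) (x + s *: v + t *: w))) [X in _ + (X - _)]E.
apply: le_trans (ler_normD _ _) _; rewrite (splitr e).
by apply: lerD; apply: ltW; [exact: H1|rewrite distrC; exact: H2].
Qed.

(** A ball around x inside U contains the segments from x, along which the mean value theorem
    applies. *)
Lemma derive0_constant (U : set 'rV[R]_n) g x : open U -> U x ->
  (forall y, U y -> differentiable g y) ->
  (forall y v, U y -> 'D_v g y = 0) ->
  \forall y \near x, g y = g x.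
Proof.
move=> oU Ux dg Dg; have : \forall y \near x, U y by exact: open_nbhs_nbhs.
move=> /nbhs_normP[/= r r0 rU]; apply/nbhs_normP; exists r => //= y /= xy.
have inU t : 0 <= t <= 1 -> U (x + t *: (y - x)).
  move=> /andP[t0 t1]; apply: rU => /=.
  rewrite opprD addNKr normrN normrZ ger0_norm // distrC.
  by apply: le_lt_trans xy; rewrite ler_piMl.
have [|t th] := @mean_value_line g x (y - x) 1 ler01.
  by move=> t th; apply: dg; exact: inU.
rewrite scale1r (addrC x) subrK Dg; last exact: inU.
by rewrite mulr0 => /subr0_eq.
Qed.

End MeanValue.

(** * The ring of smooth functions on an open set *)

(* Functions are extended by 0 off [U], so that equality is equality on [U]. *)
Record smooth_fun (R : realType) n (U : set 'rV[R]_n) (oU : open U) :=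
  SmoothFun {
    smooth_val :> 'rV[R]_n -> R;
    smooth_valP : smooth_on U smooth_val;
    smooth_off : forall x, ~ U x -> smooth_val x = 0 }.

Section SmoothFun.
Variables (R : realType) (n : nat) (U : set 'rV[R]_n) (oU : open U).
Local Notation A := (smooth_fun oU).

Lemma smooth_ext (a b : A) : (forall x, U x -> a x = b x) -> a = b.
Proof.
case: a b => [f sf f0] [g sg g0] /= fg.
have E : f = g.
  by apply/funext => x; have [/fg//|Ux] := pselect (U x); rewrite f0 // g0.
by move: sf f0 sg g0; rewrite E => *; congr SmoothFun; exact: Prop_irrelevance.
Qed.

Let restrict (f : 'rV[R]_n -> R) x : R := if pselect (U x) then f x else 0.

Let restrictE f x : U x -> restrict f x = f x.
Proof. by rewrite /restrict; case: pselect. Qed.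

Let restrict_smooth f : smooth_on U f -> smooth_on U (restrict f).
Proof. by move=> sf k; apply: (Ck_eq oU) (sf k) => x Ux; rewrite restrictE. Qed.

Let restrict_off f x : ~ U x -> restrict f x = 0.
Proof. by rewrite /restrict; case: pselect. Qed.

Definition to_smooth f (sf : smooth_on U f) : A :=
  SmoothFun oU (restrict_smooth sf) (@restrict_off f).

Lemma to_smoothE f (sf : smooth_on U f) x : U x -> to_smooth sf x = f x.
Proof. exact: restrictE. Qed.

Let smooth_cst (c : R) : smooth_on U (fun=> c).
Proof. by move=> k; exact: Ck_cst. Qed.
Let smooth_add (a b : A) : smooth_on U (fun x => a x + b x).
Proof. by move=> k; apply: CkD => //; exact: smooth_valP. Qed.
Let smooth_opp (a : A) : smooth_on U (fun x => - a x).
Proof. by move=> k; apply: CkN => //; exact: smooth_valP. Qed.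
Let smooth_mul (a b : A) : smooth_on U (fun x => a x * b x).
Proof. by move=> k; apply: CkM => //; exact: smooth_valP. Qed.
Let smooth_partial i (a : A) : smooth_on U (partial i a).
Proof. by move=> k; exact: (smooth_valP a k.+1).2. Qed.

HB.instance Definition _ := gen_eqMixin A.
HB.instance Definition _ := gen_choiceMixin A.

Definition const_smooth (c : R) : A := to_smooth (smooth_cst c).
Definition add_smooth (a b : A) : A := to_smooth (smooth_add a b).
Definition opp_smooth (a : A) : A := to_smooth (smooth_opp a).
Definition mul_smooth (a b : A) : A := to_smooth (smooth_mul a b).

Let addA : associative add_smooth.
Proof.
by move=> a b c; apply: smooth_ext => x Ux; rewrite !to_smoothE // addrA.
Qed.

Let addC : commutative add_smooth.
Proof.
by move=> a b; apply: smooth_ext => x Ux; rewrite !to_smoothE // addrC.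
Qed.

Let add0 : left_id (const_smooth 0) add_smooth.
Proof.
by move=> a; apply: smooth_ext => x Ux; rewrite !to_smoothE // add0r.
Qed.

Let addN : left_inverse (const_smooth 0) opp_smooth add_smooth.
Proof.
by move=> a; apply: smooth_ext => x Ux; rewrite !to_smoothE // addNr.
Qed.

HB.instance Definition _ := GRing.isZmodule.Build A addA addC add0 addN.

Let mulA : associative mul_smooth.
Proof.
by move=> a b c; apply: smooth_ext => x Ux; rewrite !to_smoothE // mulrA.
Qed.

Let mulC : commutative mul_smooth.
Proof.
by move=> a b; apply: smooth_ext => x Ux; rewrite !to_smoothE // mulrC.
Qed.

Let mul1 : left_id (const_smooth 1) mul_smooth.
Proof.
by move=> a; apply: smooth_ext => x Ux; rewrite !to_smoothE // mul1r.
Qed.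

Let mulD : left_distributive mul_smooth add_smooth.
Proof.
by move=> a b c; apply: smooth_ext => x Ux; rewrite !to_smoothE // mulrDl.
Qed.

HB.instance Definition _ := GRing.Zmodule_isComPzRing.Build A mulA mulC mul1
  mulD.

Section Evaluation.
Variables (x : 'rV[R]_n) (Ux : U x).

Lemma smooth_addE (a b : A) : (a + b) x = a x + b x.
Proof. exact: to_smoothE. Qed.
Lemma smooth_oppE (a : A) : (- a) x = - a x.
Proof. exact: to_smoothE. Qed.
Lemma smooth_mulE (a b : A) : (a * b) x = a x * b x.
Proof. exact: to_smoothE. Qed.
Lemma smooth_zeroE : (0 : A) x = 0.
Proof. exact: to_smoothE. Qed.
Lemma smooth_oneE : (1 : A) x = 1.
Proof. exact: to_smoothE. Qed.
Lemma smooth_sumE (I : Type) (r : seq I) (P : pred I) (a : I -> A) :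
  (\sum_(i <- r | P i) a i) x = \sum_(i <- r | P i) a i x.
Proof.
apply: (big_morph (fun a : A => a x)); first exact: smooth_addE.
exact: smooth_zeroE.
Qed.
Lemma smooth_natE m : (m%:R : A) x = m%:R.
Proof.
elim: m => [|m IH]; first exact: smooth_zeroE.
by rewrite !mulrS smooth_addE smooth_oneE IH.
Qed.
Lemma smooth_expE (a : A) m : (a ^+ m) x = a x ^+ m.
Proof.
elim: m => [|m IH]; first exact: smooth_oneE.
by rewrite !exprS smooth_mulE IH.
Qed.
End Evaluation.

Lemma smooth_differentiable (a : A) x : U x -> differentiable a x.
Proof. by move=> Ux; have [da _] := smooth_valP a 1; exact: da. Qed.

Definition partial_smooth i (a : A) : A := to_smooth (smooth_partial i a).

Lemma partial_eq i (f g : 'rV[R]_n -> R) x : U x ->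
  (forall y, U y -> f y = g y) -> partial i f x = partial i g x.
Proof.
move=> Ux fg; apply: near_eq_derive.
by apply: filterS (open_nbhs_nbhs (conj oU Ux)) => y; exact: fg.
Qed.

Let partialD i (a b : A) : partial_smooth i (a - b)
  = partial_smooth i a - partial_smooth i b.
Proof.
apply: smooth_ext => x Ux; rewrite smooth_addE // smooth_oppE // !to_smoothE //.
rewrite (@partial_eq _ _ (fun y => a y - b y)) //; last first.
  by move=> y Uy; rewrite smooth_addE // smooth_oppE.
rewrite /partial (@deriveB _ _ _ a b) //; apply: diff_derivable;
  exact: smooth_differentiable.
Qed.

HB.instance Definition _ i :=
  GRing.isZmodMorphism.Build A A (partial_smooth i) (partialD i).

Let partialM i (a b : A) : partial_smooth i (a * b)
  = partial_smooth i a * b + a * partial_smooth i b.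
Proof.
apply: smooth_ext => x Ux; rewrite smooth_addE // !smooth_mulE // !to_smoothE
  //.
rewrite (@partial_eq _ _ (fun y => a y * b y)) //; last first.
  by move=> y Uy; rewrite smooth_mulE.
rewrite /partial (@deriveM _ _ a b); last 2 first.
- by apply: diff_derivable; exact: smooth_differentiable.
- by apply: diff_derivable; exact: smooth_differentiable.
by rewrite addrC; congr (_ + _); rewrite mulrC.
Qed.

Let partialC i j (a : A) : partial_smooth i (partial_smooth j a)
  = partial_smooth j (partial_smooth i a).
Proof.
have pp k l x : U x -> partial_smooth k (partial_smooth l a) x
    = partial k (partial l a) x.
  move=> Ux; rewrite to_smoothE //; apply: partial_eq => // y Uy.
  exact: to_smoothE.
apply: smooth_ext => x Ux.
transitivity (partial i (partial j a) x); first exact: pp.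
transitivity (partial j (partial i a) x); last by rewrite pp.
exact: (@derive_schwarz _ _ U a x _ _ oU Ux (smooth_valP a 2)).
Qed.

Definition smooth_derivations : derivations A n :=
  @Derivations A n (fun i => partial_smooth i) partialM partialC.

Lemma smooth_derE i (a : A) x : U x -> smooth_derivations i a x = partial i a x.
Proof. exact: to_smoothE. Qed.

Let smooth_inv (a : A) : (forall x, U x -> a x != 0) ->
  smooth_on U (fun x => (a x)^-1).
Proof. by move=> a0 k; apply: CkV => //; exact: smooth_valP. Qed.

Lemma smooth_unit (a : A) : (forall x, U x -> a x != 0) ->
  exists2 b : A, b * a = 1 & forall x, U x -> b x = (a x)^-1.
Proof.
move=> a0; exists (to_smooth (smooth_inv a0)) => [|x Ux];
  last exact: to_smoothE.
apply: smooth_ext => x Ux; rewrite smooth_mulE // to_smoothE // smooth_oneE //.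
by rewrite mulVf // a0.
Qed.

End SmoothFun.

Section Evaluation.
Variables (R : realType) (n : nat) (U : set 'rV[R]_n) (oU : open U).
Local Notation A := (smooth_fun oU).

(* [U x] is an argument because evaluation off [U] is not unital. *)
Definition smooth_eval x (Ux : U x) (a : A) : R := a x.

Variables (x : 'rV[R]_n) (Ux : U x).

Let evalB : {morph smooth_eval Ux : a b / a - b}.
Proof. by move=> a b; rewrite /smooth_eval smooth_addE // smooth_oppE. Qed.

Let evalM : monoid_morphism (smooth_eval Ux).
Proof.
by split=> [|a b]; [exact: smooth_oneE|exact: smooth_mulE].
Qed.

HB.instance Definition _ := GRing.isZmodMorphism.Build A R (smooth_eval Ux)
  evalB.
HB.instance Definition _ := GRing.isMonoidMorphism.Build A R (smooth_eval Ux)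
  evalM.

End Evaluation.

(** * Coordinate geometry as values of geometry over the ring *)

Section LiftMatrix.
Variables (R : realType) (n : nat) (U : set 'rV[R]_n) (oU : open U).
Local Notation A := (smooth_fun oU).
Local Notation ev Ux := (@smooth_eval _ _ _ oU _ Ux).

Lemma smooth_coord p q (f : 'rV[R]_n -> 'M[R]_(p, q)) i j :
  smooth_on U f -> smooth_on U (fun x => f x i j).
Proof. by move=> sf k; exact: Ck_coord. Qed.

Definition lift_mx p q (f : 'rV[R]_n -> 'M[R]_(p, q)) (sf : smooth_on U f) :
  'M[A]_(p, q) := \matrix_(i, j) to_smooth oU (smooth_coord i j sf).

Lemma lift_mxE p q (f : 'rV[R]_n -> 'M[R]_(p, q)) (sf : smooth_on U f) i j x :
  U x -> lift_mx sf i j x = f x i j.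
Proof. by move=> Ux; rewrite mxE to_smoothE. Qed.

Lemma eval_lift_mx p q (f : 'rV[R]_n -> 'M[R]_(p, q)) (sf : smooth_on U f) x
  (Ux : U x) : map_mx (ev Ux) (lift_mx sf) = f x.
Proof. by apply/matrixP=> i j; rewrite mxE; exact: lift_mxE. Qed.

(** The inverse is the adjugate divided by the determinant, which vanishes nowhere on [U] and so is
    a unit of the ring; at each point it must be [invmx] by uniqueness of inverses. *)
Lemma lift_mx_inverse p (f : 'rV[R]_n -> 'M[R]_p) (sf : smooth_on U f) :
  (forall x, U x -> f x \in unitmx) ->
  exists2 K : 'M[A]_p, K *m lift_mx sf = 1%:M
  & forall x (Ux : U x), map_mx (ev Ux) K = invmx (f x).
Proof.
move=> fu; set G := lift_mx sf.
have [x Ux|b bG _] := @smooth_unit _ _ _ oU (\det G).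
  by rewrite -[_ x]/(ev Ux _) -det_map_mx eval_lift_mx -unitfE -unitmxE fu.
exists (b *: \adj G).
  by rewrite -scalemxAl mul_adj_mx scale_scalar_mx bG.
move=> x Ux; have := fu x Ux => fux.
rewrite -[LHS]mulmx1 -(mulmxV fux) mulmxA.
rewrite -[X in _ *m X *m _](eval_lift_mx sf Ux) -map_mxM -/G.
by rewrite -scalemxAl mul_adj_mx scale_scalar_mx bG map_mx1 mul1mx.
Qed.

End LiftMatrix.

Section LiftGeometry.
Variables (R : realType) (n : nat) (U : set 'rV[R]_n) (oU : open U).
Local Notation A := (smooth_fun oU).
Local Notation ev Ux := (@smooth_eval _ _ _ oU _ Ux).
Local Notation d := (smooth_derivations oU).
Variables (f : 'rV[R]_n -> 'M[R]_n) (sf : smooth_on U f).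
Variables (K : 'M[A]_n).
Hypothesis KE : forall x (Ux : U x), map_mx (ev Ux) K = invmx (f x).

Definition smooth_half : A := const_smooth oU 2^-1.

Lemma smooth_halfD : smooth_half + smooth_half = 1.
Proof.
apply: smooth_ext => x Ux; rewrite smooth_addE // smooth_oneE // /smooth_half
  !to_smoothE //.
by rewrite [RHS]splitr mul1r.
Qed.

Local Notation Gamma := (christoffel_mx d smooth_half (lift_mx oU sf) K).

(** The passage from pointwise to ring derivatives: [U] is open, so the values of [F] off [U] have
    no influence. *)
Lemma lift_partial i (F : 'rV[R]_n -> R) (a : A) x (Ux : U x) :
  (forall y, U y -> F y = a y) -> partial i F x = ev Ux (d i a).
Proof.
move=> Fa; rewrite /smooth_eval smooth_derE //.
exact: (partial_eq oU i Ux Fa).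
Qed.

Lemma invmx_lift x (Ux : U x) i j : invmx (f x) i j = ev Ux (K i j).
Proof. by rewrite -(KE Ux) mxE. Qed.

Lemma lift_christoffel i j k x (Ux : U x) :
  christoffel f i j k x = ev Ux (Gamma i j k).
Proof.
rewrite mxE rmorphM rmorph_sum /christoffel; congr (_ * _).
  by apply: esym; exact: to_smoothE.
apply: eq_bigr => l _; rewrite rmorphM rmorphB rmorphD (invmx_lift Ux).
have dG a b c : partial a (fun y => f y b c) x
    = ev Ux (d a (lift_mx oU sf b c)).
  by apply: lift_partial => y Uy; rewrite lift_mxE.
by rewrite !dG.
Qed.

Lemma lift_riemann i j k l x (Ux : U x) :
  riemann f i j k l x = ev Ux (curvature_mx d Gamma i j k l).
Proof.
have dG a b c e : partial a (christoffel f b c e) x = ev Ux (d a (Gamma b c e)).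
  by apply: lift_partial => y Uy; rewrite lift_christoffel.
rewrite curvature_mxE rmorphD rmorphB rmorph_sum; congr (_ - _ + _).
- exact: dG.
- exact: dG.
apply: eq_bigr => s _; rewrite rmorphB !(lift_christoffel _ _ _ Ux).
by congr (_ - _); exact: esym (rmorphM _ _ _).
Qed.

Lemma lift_ricci j k x (Ux : U x) :
  ricci f j k x = ev Ux (ricci_mx d Gamma j k).
Proof.
rewrite mxE rmorph_sum; apply: eq_bigr => i _; exact: lift_riemann.
Qed.

Lemma lift_scalar_curvature x (Ux : U x) : scalar_curvature f x
  = ev Ux (\sum_j \sum_k K j k * ricci_mx d Gamma j k).
Proof.
rewrite rmorph_sum; apply: eq_bigr => j _; rewrite rmorph_sum.
by apply: eq_bigr => k _; rewrite rmorphM (invmx_lift Ux) (lift_ricci _ _ Ux).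
Qed.

Lemma lift_laplacian (F : 'rV[R]_n -> R) (a : A) x (Ux : U x) :
  (forall y, U y -> F y = a y) ->
  laplacian f F x = ev Ux (formal_laplacian d K Gamma a).
Proof.
move=> Fa.
have gE i y (Uy : U y) : gradient f F y 0 i = ev Uy (formal_gradient d K a 0 i).
  rewrite !mxE rmorph_sum; apply: eq_bigr => j _.
  by rewrite rmorphM (invmx_lift Uy) (lift_partial j Uy Fa).
rewrite rmorph_sum; apply: eq_bigr => i _; rewrite rmorphD rmorph_sum.
congr (_ + _); first by apply: lift_partial => y Uy; rewrite gE.
by apply: eq_bigr => j _; rewrite rmorphM (gE _ _ Ux) (lift_christoffel _ _ _
  Ux).
Qed.

End LiftGeometry.

Lemma map_mx_sum (V W : nmodType) (f : {additive V -> W}) p q (I : Type)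
    (r : seq I) (P : pred I) (X : I -> 'M[V]_(p, q)) :
  map_mx f (\sum_(i <- r | P i) X i) = \sum_(i <- r | P i) map_mx f (X i).
Proof.
apply/matrixP=> k l; rewrite !mxE !summxE raddf_sum.
by apply: eq_bigr => i _; rewrite mxE.
Qed.

Section LiftMap.
Variables (R : realType) (n : nat).
Variables (U U' : set 'rV[R]_n) (oU : open U) (oU' : open U').
Variables (F : 'rV[R]_n -> 'rV[R]_n) (sF : smooth_on U F).
Variables (FU : forall x, U x -> U' (F x)).
Local Notation A := (smooth_fun oU).
Local Notation B := (smooth_fun oU').
Local Notation ev Ux := (@smooth_eval _ _ _ oU _ Ux).
Local Notation ev' Ux := (@smooth_eval _ _ _ oU' _ Ux).
Local Notation dA := (smooth_derivations oU).
Local Notation dB := (smooth_derivations oU').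

Lemma smooth_comp (b : B) : smooth_on U (b \o F).
Proof. by move=> k; apply: Ck_comp (smooth_valP b k);
  [exact: oU|exact: FU|exact: sF]. Qed.

Definition smooth_pull (b : B) : A := to_smooth oU (smooth_comp b).

Lemma smooth_pullE b x : U x -> smooth_pull b x = b (F x).
Proof. by move=> Ux; rewrite to_smoothE. Qed.

Let pullB : {morph smooth_pull : a b / a - b}.
Proof.
move=> a b; apply: smooth_ext => x Ux; have Fx := FU Ux.
rewrite smooth_addE // smooth_oppE // !smooth_pullE //.
by rewrite smooth_addE // smooth_oppE.
Qed.

Let pullM : monoid_morphism smooth_pull.
Proof.
split=> [|a b]; apply: smooth_ext => x Ux; have Fx := FU Ux.
  by rewrite smooth_pullE // !smooth_oneE.
by rewrite smooth_mulE // !smooth_pullE // smooth_mulE.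
Qed.

HB.instance Definition _ := GRing.isZmodMorphism.Build B A smooth_pull pullB.
HB.instance Definition _ := GRing.isMonoidMorphism.Build B A smooth_pull pullM.

Definition smooth_jacobian : 'M[A]_n :=
  \matrix_(i, b) dA i (lift_mx oU sF 0 b).

Local Notation J := smooth_jacobian.

Lemma smooth_jacobian_closed i j b : dA i (J j b) = dA j (J i b).
Proof. by rewrite !mxE derC. Qed.

Lemma smooth_jacobianE i b x (Ux : U x) :
  partial i (fun y => F y 0 b) x = ev Ux (J i b).
Proof. by rewrite mxE; apply: lift_partial => y Uy; rewrite lift_mxE. Qed.

Let dF x : U x -> differentiable F x.
Proof. by move=> Ux; have [+ _] := sF 1; exact. Qed.

Lemma partial_rowE i b x : U x -> partial i (fun y => F y 0 b) x
  = ('D_(delta_mx 0 i) F x) 0 b.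
Proof.
move=> Ux; rewrite derive_mx ?mxE //; apply: diff_derivable; exact: dF.
Qed.

Lemma eval_jacobian x (Ux : U x) : map_mx (ev Ux) J = 'J F x.
Proof.
apply/matrixP=> i b; rewrite mxE -smooth_jacobianE partial_rowE //.
rewrite (deriveEjacobian _ (dF Ux)) -rowE mxE //.
Qed.

Lemma smooth_chain i (b : B) :
  dA i (smooth_pull b) = \sum_c J i c * smooth_pull (dB c b).
Proof.
apply: smooth_ext => x Ux; rewrite smooth_derE // smooth_sumE //.
rewrite (partial_eq oU i (g := b \o F) Ux); last first.
  by move=> y Uy; exact: smooth_pullE.
rewrite /partial (derive_comp_partial _ (dF Ux)); last first.
  by apply: smooth_differentiable; exact: FU.
apply: eq_bigr => c _; rewrite smooth_mulE // smooth_pullE //.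
rewrite smooth_derE; last exact: FU.
by rewrite -[J i c x]/(ev Ux (J i c)) -smooth_jacobianE partial_rowE.
Qed.

Variables (f h : 'rV[R]_n -> 'M[R]_n).
Variables (sf : smooth_on U f) (sh : smooth_on U' h).
Variables (K : 'M[A]_n) (L : 'M[B]_n).
Hypothesis KE : forall x (Ux : U x), map_mx (ev Ux) K = invmx (f x).
Hypothesis LE : forall x (Ux : U' x), map_mx (ev' Ux) L = invmx (h x).

Local Notation Gamma := (christoffel_mx dA (smooth_half oU) (lift_mx oU sf) K).
Local Notation Om := (christoffel_mx dB (smooth_half oU') (lift_mx oU' sh) L).
Local Notation Theta := (pullback_conn smooth_pull J Om).
Local Notation Rm := (fun c e => map_mx smooth_pull (curvature_mx dB Om c e)).

Lemma lift_differential_field i x (Ux : U x) :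
  differential_field F i x = map_mx (ev Ux) (row i J).
Proof. by apply/rowP=> b; rewrite 3!mxE (smooth_jacobianE i b Ux). Qed.

Lemma lift_pullback_nabla i (W : 'rV[R]_n -> 'rV[R]_n) (V : 'rV[A]_n) x
    (Ux : U x) : (forall y (Uy : U y), W y = map_mx (ev Uy) V) ->
  pullback_nabla h F i W x = map_mx (ev Ux) (formal_nabla dA Theta i V).
Proof.
move=> WV; apply/rowP=> b; rewrite mxE [RHS]mxE [formal_nabla _ _ _ _ _ _]mxE.
rewrite raddfD /=; congr (_ + _).
  by rewrite dmxE; apply: lift_partial => y Uy; rewrite (WV y Uy) mxE.
rewrite mxE raddf_sum exchange_big; apply: eq_bigr => e _ /=.
transitivity (ev Ux (V 0 e) * ev Ux (Theta i e b)).
  rewrite -mulr_suml mulrC (WV x Ux) [map_mx _ V _ _]mxE; congr (_ * _).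
  rewrite summxE raddf_sum; apply: eq_bigr => c _.
  rewrite (lift_christoffel sh LE _ _ _ (FU Ux)) (lift_differential_field i Ux).
  rewrite [map_mx _ _ _ _]mxE row_mxE scalemxE [map_mx _ _ _ _]mxE mulrC.
  rewrite -[RHS]/(ev Ux (J i c * smooth_pull (Om c e b))) rmorphM.
  congr (_ * _).
  by rewrite -[RHS]/(smooth_pull _ x) smooth_pullE.
exact: esym (rmorphM _ _ _).
Qed.

Lemma lift_tension x (Ux : U x) : tension f h F x
  = map_mx (ev Ux) (formal_tension dA K Gamma Theta J).
Proof.
rewrite [RHS]map_mx_sum; apply: eq_bigr => i _.
rewrite [RHS]map_mx_sum; apply: eq_bigr => j _.
rewrite (invmx_lift KE Ux) map_mxZ; congr (_ *: _).
rewrite [RHS]map_mxB; congr (_ - _).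
  by apply: lift_pullback_nabla => y Uy; exact: lift_differential_field.
rewrite [RHS]map_mx_sum; apply: eq_bigr => k _.
rewrite (lift_christoffel sf KE _ _ _ Ux) (lift_differential_field k Ux).
by rewrite [RHS]map_mxZ.
Qed.

Lemma lift_bitension x (Ux : U x) : bitension f h F x
  = map_mx (ev Ux) (formal_bitension dA K Gamma Theta J Rm).
Proof.
(* The identity is taken at all points of [U], because the tension is about to be differentiated
   twice. *)
have tE y (Uy : U y) := lift_tension Uy.
have nE i y (Uy : U y) := lift_pullback_nabla i Uy tE.
rewrite [RHS]map_mxB map_mxN; congr (- _ - _).
  rewrite [RHS]map_mx_sum; apply: eq_bigr => i _.
  rewrite [RHS]map_mx_sum; apply: eq_bigr => j _.
  rewrite (invmx_lift KE Ux) map_mxZ; congr (_ *: _).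
  rewrite [RHS]map_mxB; congr (_ - _); first exact: (lift_pullback_nabla _ _ (nE
    j)).
  rewrite [RHS]map_mx_sum; apply: eq_bigr => k _.
  by rewrite (lift_christoffel sf KE _ _ _ Ux) (nE k x Ux) [RHS]map_mxZ.
rewrite [RHS]map_mx_sum; apply: eq_bigr => i _.
rewrite [RHS]map_mx_sum; apply: eq_bigr => j _.
rewrite (invmx_lift KE Ux) map_mxZ; congr (_ *: _).
rewrite tE !lift_differential_field; apply/rowP=> b.
rewrite [LHS]mxE [RHS]mxE [formal_curvature _ _ _ _ _ _]mxE.
rewrite [RHS]rmorph_sum; apply: eq_bigr => c _.
rewrite [RHS]rmorph_sum; apply: eq_bigr => e _.
rewrite [RHS]rmorph_sum; apply: eq_bigr => s _.
rewrite ![map_mx (ev Ux) _ _ _]mxE [RHS]rmorphM [X in _ = X * _]rmorphM.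
rewrite [X in _ = X * _ * _]rmorphM (lift_riemann sh LE _ _ _ _ (FU Ux)).
congr (_ * _ * _ * _); rewrite [map_mx _ _ _ _]mxE.
by rewrite -[RHS]/(smooth_pull _ x) smooth_pullE.
Qed.

End LiftMap.

Lemma posdef_unitmx (R : realFieldType) n (G : 'M[R]_n) :
  (forall v : 'rV_n, v != 0 -> 0 < (v *m G *m v^T) 0 0) -> G \in unitmx.
Proof.
move=> Gpos; rewrite unitmxE unitfE; apply/det0P => -[v v0 vG].
by have := Gpos v v0; rewrite vG mul0mx mxE ltxx.
Qed.

(** * The theorem in one pair of charts *)

Section LocalTheorem.
Variables (R : realType).
Variables (U U' : set 'rV[R]_4) (oU : open U) (oU' : open U').
Variables (F : 'rV[R]_4 -> 'rV[R]_4) (sF : smooth_on U F).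
Variables (FU : forall x, U x -> U' (F x)).
Variables (g h : 'rV[R]_4 -> 'M[R]_4).
Variables (sg : smooth_on U g) (sh : smooth_on U' h).
Hypotheses (g_sym : forall x, U x -> (g x)^T = g x)
  (h_sym : forall x, U' x -> (h x)^T = h x)
  (g_unit : forall x, U x -> g x \in unitmx)
  (h_unit : forall x, U' x -> h x \in unitmx).
Variables (l : 'rV[R]_4 -> R) (sl : smooth_on U l).
Hypothesis l0 : forall x, U x -> l x != 0.
Hypothesis conformal : forall x, U x ->
  'J F x *m h (F x) *m ('J F x)^T = l x ^+ 2 *: g x.
Variable a : R.
Hypothesis einstein : forall x, U x -> forall j k, ricci g j k x = a * g x j k.

Local Notation A := (smooth_fun oU).
Local Notation dA := (smooth_derivations oU).
Local Notation dB := (smooth_derivations oU').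
Local Notation ev Ux := (@smooth_eval _ _ _ oU _ Ux).

(** The equation of the theorem solved for A: this is (S - a) / lambda^2. *)
Definition conformal_quantity (x : 'rV[R]_4) : R :=
  ((l x)^-1 * laplacian g l x - a) / l x ^+ 2.

Lemma local_conformal : exists q : A,
  [/\ forall x, U x -> q x = conformal_quantity x,
  (forall x, U x -> bitension g h F x = 0) <-> (forall i, dA i q = 0)
  & forall x, U x -> scalar_curvature h (F x)
     = (4 * a - 6 * ((l x)^-1 * laplacian g l x)) / l x ^+ 2].
Proof.
have [K KG KE] := lift_mx_inverse oU sg g_unit.
have [L LH LE] := lift_mx_inverse oU' sh h_unit.
pose l1 : A := to_smooth oU sl.
have l1E x (Ux : U x) : l1 x = l x by exact: to_smoothE.
have [l' ll l'E] : exists2 b : A, b * l1 = 1 & forall x, U x -> b x = (l1 x)^-1.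
  by apply: smooth_unit => x Ux; rewrite l1E // l0.
pose G := lift_mx oU sg; pose H := lift_mx oU' sh.
have Gs : G^T = G.
  apply/matrixP=> i j; rewrite mxE; apply: smooth_ext => x Ux.
  by rewrite !lift_mxE // -[in RHS]g_sym // mxE.
have Hs : H^T = H.
  apply/matrixP=> i j; rewrite mxE; apply: smooth_ext => x Ux.
  by rewrite !lift_mxE // -[in RHS]h_sym // mxE.
pose Gamma := christoffel_mx dA (smooth_half oU) G K.
pose Om := christoffel_mx dB (smooth_half oU') H L.
have lcG : levi_civita dA G Gamma by apply: christoffel_mx_levi_civita => //;
  exact: smooth_halfD.
have lcH : levi_civita dB H Om by apply: christoffel_mx_levi_civita => //;
  exact: smooth_halfD.
pose J := smooth_jacobian oU sF.
pose pull := @smooth_pull _ _ U U' oU oU' F sF FU.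
have conf : J *m map_mx pull H *m J^T = l1 ^+ 2 *: G.
  apply/matrixP=> i j; apply: smooth_ext => x Ux.
  have := congr1 (fun M : 'M[R]_4 => M i j) (conformal Ux).
  rewrite -(eval_jacobian oU sF Ux) scalemxE.
  have -> : h (F x) = map_mx (ev Ux) (map_mx pull H).
    apply/matrixP=> b c; rewrite 2!mxE.
    by rewrite -[RHS]/(pull _ x) smooth_pullE // lift_mxE //; exact: FU.
  rewrite map_trmx -!map_mxM [map_mx _ _ _ _]mxE => E.
  by rewrite -[LHS]/(ev Ux _) E scalemxE smooth_mulE // smooth_expE // l1E //
    lift_mxE.
pose ac : A := const_smooth oU a.
have dac i : dA i ac = 0.
  apply: smooth_ext => x Ux; rewrite smooth_derE // smooth_zeroE //.
  rewrite (partial_eq oU i (g := fun=> a) Ux) => [|y Uy];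
    last exact: to_smoothE.
  by rewrite /partial derive_cst.
have ein : ricci_mx dA Gamma = ac *: G.
  apply/matrixP=> j k; apply: smooth_ext => x Ux.
  rewrite scalemxE smooth_mulE // lift_mxE // to_smoothE // -einstein //.
  by rewrite (lift_ricci sg KE j k Ux).
have n4 : 4%:R = 4 :> A by [].
have lapE x (Ux : U x) :
    laplacian g l x = ev Ux (formal_laplacian dA K Gamma l1).
  by apply: lift_laplacian => // y Uy; rewrite l1E.
have l'x x : U x -> l' x = (l x)^-1 by move=> Ux; rewrite l'E // l1E.
have Jc := smooth_jacobian_closed oU sF.
have chain := @smooth_chain _ _ U U' oU oU' F sF FU.
exists (l' ^+ 2 * (l' * formal_laplacian dA K Gamma l1 - ac)); split.
- move=> x Ux; rewrite /conformal_quantity (lapE x Ux) smooth_mulE //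
  smooth_expE //.
  rewrite smooth_addE // smooth_mulE // smooth_oppE // to_smoothE // l'x //.
  by rewrite mulrC exprVn.
- have := formal_biharmonicP Jc chain Hs lcH (smooth_halfD oU) Gs KG lcG ll conf
  n4 dac ein.
  move=> <-; split=> [bit|bit x Ux].
    apply/rowP=> b; apply: smooth_ext => x Ux; have := bit x Ux.
    rewrite (lift_bitension sF FU sg sh KE LE Ux) => /rowP/(_ b).
    by rewrite !mxE smooth_zeroE.
  by rewrite (lift_bitension sF FU sg sh KE LE Ux) bit map_mx0.
move=> x Ux.
rewrite (lift_scalar_curvature sh LE (FU Ux)).
have := formal_scalar_curvature Jc chain Hs LH lcH (smooth_halfD oU) Gs KG lcG
  ll conf n4 ein.
move=> /(congr1 (ev Ux)); rewrite -[LHS]/(pull _ x) smooth_pullE // => E.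
apply: (etrans E); rewrite (lapE x Ux) /smooth_eval smooth_mulE // smooth_expE
  // smooth_addE //.
rewrite smooth_oppE // !smooth_mulE // !smooth_natE // to_smoothE // l'x //.
by rewrite mulrC exprVn.
Qed.

End LocalTheorem.

(** * Passing to manifolds *)

Section DerivationConstant.
Variables (R : realType) (n : nat) (U : set 'rV[R]_n) (oU : open U).
Variable q : smooth_fun oU.
Local Notation d := (smooth_derivations oU).

Lemma smooth_der_eq0 x : U x -> (forall i, d i q = 0) ->
  \forall y \near x, q y = q x.
Proof.
move=> Ux dq; apply: (derive0_constant oU Ux) => [y Uy|y v Uy].
  exact: smooth_differentiable.
rewrite derive_sum_partial; last exact: smooth_differentiable.
by rewrite big1 // => b _; rewrite -(smooth_derE b q Uy) dq smooth_zeroE //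
  mulr0.
Qed.

Lemma smooth_der_const (c : R) : (forall x, U x -> q x = c) ->
  forall i, d i q = 0.
Proof.
move=> qc i; apply: smooth_ext => x Ux; rewrite smooth_derE // smooth_zeroE //.
by rewrite (partial_eq oU i (g := fun=> c) Ux qc) /partial derive_cst.
Qed.

End DerivationConstant.

(** The level set through [p0] is nonempty, open and closed. *)
Lemma locally_constant_connected (T : topologicalType) (V : Type) (f : T -> V)
    (p0 : T) : connected [set: T] ->
  (forall p, \forall p' \near p, f p' = f p) -> forall p, f p = f p0.
Proof.
move=> Tc fl p; suff : [set q | f q = f p0] = setT.
  by move/seteqP => [_ /(_ p)]; apply.
apply: Tc; first by exists p0.
- exists [set q | f q = f p0]; last by rewrite setTI.
  by rewrite openE => q /= <-; exact: fl.
- exists [set q | f q = f p0]; last by rewrite setTI.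
  rewrite -openC openE => q /= fq.
  by apply: filterS (fl q) => q' /= ->.
Qed.

Section Charts.
Variables (R : realType) (M N : manifold R 4).
Variables (g : metric M) (h : metric N) (a : R) (phi : M -> N).
Variable lambda : M -> R.
Variables (M_einstein : einstein g a) (phi_smooth : smooth_map phi)
  (lambda_smooth : smooth_function lambda) (lambda_gt0 : forall p, 0 < lambda p)
  (phi_conformal : conformal_with_factor g h phi lambda).

Definition chart_domain (c : chart_index M) (d : chart_index N) :=
  chart c @` (dom c `&` phi @^-1` dom d).

Lemma chart_domain_open c d : open (chart_domain c d).
Proof.
rewrite openE => _ [p [cp dp] <-].
have oO : open (dom c `&` phi @^-1` dom d).
  apply: openI; first exact: dom_open.
  by apply: open_comp; [move=> q _; exact: phi_smooth.1|exact: dom_open].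
(* As [param c] is arbitrary off the image of the chart, nearby points must be known to lie in that
   image before [n2] can be used. *)
have n1 : nbhs (chart c p) (chart c @` dom c).
  by apply: open_nbhs_nbhs; split; [exact: codom_open|exists p].
have n2 : nbhs (chart c p) (param c @^-1` (dom c `&` phi @^-1` dom d)).
  apply: (param_continuous cp); rewrite chartK //.
  by apply: open_nbhs_nbhs; split.
apply: filterS2 n1 n2 => x [q cq <-] /=; rewrite chartK // => qO.
by exists q.
Qed.

Arguments chart_domain_open : clear implicits.

Local Notation q c := (conformal_quantity (g c) (lambda \o param c) a).

Lemma chart_conformal c d : exists q1 : smooth_fun (chart_domain_open c d),
  [/\ forall x, chart_domain c d x -> q1 x = q c x,
  (forall x, chart_domain c d x ->
     bitension (g c) (h d) (local_rep phi c d) x = 0)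
    <-> (forall i, smooth_derivations (chart_domain_open c d) i q1 = 0)
  & forall p, dom c p -> dom d (phi p) ->
    scalar_curvature (h d) (chart d (phi p))
     = (4 * a - 6 * ((lambda p)^-1
                     * laplacian (g c) (lambda \o param c) (chart c p)))
       / lambda p ^+ 2].
Proof.
have sub : chart_domain c d `<=` chart c @` dom c.
  by move=> _ [p [cp _] <-]; exists p.
have FU x : chart_domain c d x -> (chart d @` dom d) (local_rep phi c d x).
  by move=> [p [cp dp] <-]; rewrite /local_rep /= chartK //; exists (phi p).
have restr (V : normedModType R) (f : 'rV[R]_4 -> V) :
    smooth_on (chart c @` dom c) f -> smooth_on (chart_domain c d) f.
  by move=> sf k; exact: Ck_sub (sf k).
have [|||||||q1 [q1E q1b q1s]] := @local_conformal R _ _ (chart_domain_open c d)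
    (@codom_open _ _ N d) (local_rep phi c d) (phi_smooth.2 c d) FU
    (g c) (h d) (restr _ _ (@gram_smooth _ _ _ g c)) (@gram_smooth _ _ _ h d)
    _ _ _ _ _ (restr _ _ (lambda_smooth c)) _ _ a _.
- by move=> _ [p [cp _] <-]; exact: gram_sym.
- by move=> _ [p dp <-]; exact: gram_sym.
- by move=> _ [p [cp _] <-]; apply: posdef_unitmx; exact: gram_posdef.
- by move=> _ [p dp <-]; apply: posdef_unitmx; exact: gram_posdef.
- by move=> _ [p [cp _] <-] /=; rewrite chartK // gt_eqF.
- move=> _ [p [cp dp] <-]; have := phi_conformal cp dp.
  by rewrite /local_rep /= chartK.
- by move=> _ [p [cp dp] <-] j k; exact: M_einstein.
exists q1; split=> // p cp dp.
have := q1s (chart c p); rewrite /local_rep /= chartK //; apply.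
by exists p.
Qed.

(* The scalar curvature of the target at [phi p] determines the Laplacian. *)
Lemma laplacian_chart c c' p : dom c p -> dom c' p ->
  laplacian (g c) (lambda \o param c) (chart c p)
  = laplacian (g c') (lambda \o param c') (chart c' p).
Proof.
move=> cp cp'; have [d dp] := dom_cover (phi p).
have [_ [_ _ s]] := chart_conformal c d.
have [_ [_ _ s']] := chart_conformal c' d.
have l0 : lambda p != 0 by rewrite gt_eqF.
have /(mulIf (invr_neq0 (expf_neq0 2 l0))) :=
  etrans (esym (s p cp dp)) (s' p cp' dp).
move: (laplacian _ _ _) (laplacian _ _ _) => L L' E.
by apply: (mulfI (invr_neq0 l0)); lra.
Qed.

End Charts.

Theorem theorem2p3 (R : realType) (M N : manifold R 4)
    (g : metric M) (h : metric N) (a : R) (phi : M -> N) (lambda : M -> R)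
    (M_connected : connected [set: M])
    (M_einstein : einstein g a)
    (phi_smooth : smooth_map phi)
    (lambda_smooth : smooth_function lambda)
    (lambda_gt0 : forall p, 0 < lambda p)
    (phi_conformal : conformal_with_factor g h phi lambda) :
  let factor_equation (A : R) :=
    forall (c : chart_index M) (p : M), dom c p ->
      laplacian (g c) (lambda \o param c) (chart c p) - a * lambda p
      = A * lambda p ^+ 3 in
  (biharmonic g h phi <-> exists A : R, factor_equation A) /\
  (forall A : R, factor_equation A ->
     forall (d : chart_index N) (p : M), dom d (phi p) ->
       6 * A + 2 * a / lambda p ^+ 2
       + scalar_curvature (h d) (chart d (phi p)) = 0).
Proof.
move=> factor_equation.
have conf c d := chart_conformal M_einstein phi_smooth lambda_smooth lambda_gt0
  phi_conformal c d.
have lapC c c' p := @laplacian_chart _ _ _ _ _ _ _ _ M_einstein phi_smooth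
  lambda_smooth lambda_gt0 phi_conformal c c' p.
pose q c := conformal_quantity (g c) (lambda \o param c) a.
have l0 p : lambda p != 0 by rewrite gt_eqF.
have qE c p : dom c p -> q c (chart c p) =
    ((lambda p)^-1 * laplacian (g c) (lambda \o param c) (chart c p) - a)
    / lambda p ^+ 2.
  by move=> cp; rewrite /q /conformal_quantity /= chartK.
have factorE c p A : dom c p -> q c (chart c p) = A <->
    laplacian (g c) (lambda \o param c) (chart c p) - a * lambda p
    = A * lambda p ^+ 3.
  move=> cp; rewrite qE //; move: (laplacian _ _ _) => L; split=> [<-|E].
    by field; exact: l0.
  have -> : L = A * lambda p ^+ 3 + a * lambda p by rewrite -E subrK.
  by field; exact: l0.
split; first split.
- move=> bih.
  (* [M] may be empty, in which case any constant will do. *)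
  have [[p0 _]|M0] := pselect (exists p : M, True); last first.
    by exists 0 => c p; case: M0; exists p.
  (* The local quantities are glued by choosing a chart at each point; [QE] shows that the choice is
     immaterial, by [laplacian_chart]. *)
  pose Q p := let c := projT1 (cid (dom_cover p)) in q c (chart c p).
  have QE c p : dom c p -> Q p = q c (chart c p).
    move=> cp; rewrite /Q; case: cid => c' /= cp'.
    by rewrite (qE _ _ cp') (qE _ _ cp) (lapC c' c p cp' cp).
  exists (Q p0) => c p cp; apply/factorE => //; rewrite -QE //.
  apply: locally_constant_connected M_connected _ _ => {cp} p1.
  have [c1 cp1] := dom_cover p1; have [d dp1] := dom_cover (phi p1).
  have [q1 [q1E q1b _]] := conf c1 d.
  have dq0 : forall i, smooth_derivations _ i q1 = 0.
    apply/q1b => _ [p2 [cp2 dp2] <-]; exact: bih.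
  have D1 : chart_domain phi c1 d (chart c1 p1) by exists p1.
  have near_q := smooth_der_eq0 D1 dq0.
  have oD := @chart_domain_open _ _ _ phi phi_smooth c1 d.
  have near_D : \forall x \near chart c1 p1, chart_domain phi c1 d x.
    exact: open_nbhs_nbhs.
  have near_p : \forall p' \near p1, dom c1 p'.
    by apply: open_nbhs_nbhs; split => //; exact: dom_open.
  (* Local constancy in coordinates is transported to [M] by continuity of the chart. *)
  have near1 := chart_continuous cp1 near_q.
  have near2 := chart_continuous cp1 near_D.
  apply: filterS3 near_p near1 near2 => p' cp' /= qq Dp'.
  by rewrite (QE c1 p') // (QE c1 p1) // /q -q1E // -q1E.
- move=> [A fA] c d p cp dp.
  have [q1 [q1E q1b _]] := conf c d.
  apply: (q1b.2 _ (chart c p)); last by exists p.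
  apply: (smooth_der_const (c := A)) => x Dx; rewrite q1E //.
  by case: Dx => p' [cp' _] <-; apply/factorE => //; exact: fA.
move=> A fA d p dp; have [c cp] := dom_cover p.
have [_ [_ _ s]] := conf c d.
(* The factor equation says S = a + A lambda^2, and then (4 a - 6 S) / lambda^2 is -2 a / lambda^2 -
   6 A. *)
have := fA c p cp; rewrite s //; move: (laplacian _ _ _) => L E.
have -> : L = A * lambda p ^+ 3 + a * lambda p by rewrite -E subrK.
by field; exact: l0.
Qed.
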